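(* Let $\mu>0$ and let $\Phi:\mathbb R_+\to\mathbb R_+$ belong to $L^1(\mathbb R_+;dt)$ with $\|\Phi\|_1<1$. Let $X=\sum_{n\ge1}X^{(n)}$ where, for $t\ge0$, $$X^{(1)}_t=\int_{(0,t]\times\mathbb R_+}\mathbf 1_{\{\theta_1\le\mu\}}N(dv_1,d\theta_1),$$ and for $n\ge2$, $$X^{(n)}_t=\int_{(0,t]\times\mathbb R_+}\int_{(0,v_n)\times\mathbb R_+}\cdots\int_{(0,v_2)\times\mathbb R_+}\mathbf 1_{\{\theta_1\le\mu\}}\prod_{i=2}^n\mathbf 1_{\{\theta_i\le\Phi(v_i-v_{i-1})\}}N(dv_1,d\theta_1)\cdots N(dv_n,d\theta_n),$$ and let $$\ell_t=\mu+\int_{(0,t)}\Phi(t-r)\,dX_r,\qquad M_t=X_t-\int_{(0,t)}\ell_u\,du,\qquad t\ge0 .$$ Then $X$ is an $\mathbb N$-valued non-decreasing, piecewise constant process with predictable intensity process $\ell$, in the sense that the process $M$ is an $\mathbb F^N$-martingale (and hence also an $\mathbb F^X$-martingale).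
   Context: $N$ is a Poisson random measure on $\mathbb R_+^2$ with intensity $dt\,d\theta$ on a probability space $(\Omega,\mathcal F,\mathbb P)$. $\mathbb F^N=(\mathcal F^N_t)_{t\ge0}$ with $\mathcal F^N_t=\sigma(N(\mathcal T\times B):\mathcal T\in\mathcal B([0,t]),B\in\mathcal B(\mathbb R_+))$. $\mathbb F^X=(\mathcal F^X_t)_{t\ge0}$ with $\mathcal F^X_t=\sigma(X_s,\ s\le t)$. The series defining $X$ converges uniformly on compact time intervals in the sense that $\mathbb E[\sup_{t\in[0,T]}|X_t-\sum_{n=1}^pX^{(n)}_t|]\to0$ as $p\to\infty$ for all $T>0$. *)

(* Defs.v *)
From HB Require Import structures.
From mathcomp Require Import all_boot all_order all_algebra.
From mathcomp Require Import all_classical all_reals all_analysis.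
From mathcomp Require Import measurable_realfun.

Set Implicit Arguments.
Unset Strict Implicit.
Unset Printing Implicit Defensive.
Import Order.TTheory GRing.Theory Num.Theory.
Import numFieldNormedType.Exports.

Local Open Scope classical_set_scope.
Local Open Scope ring_scope.

(* The Borel plane; time is the first coordinate, the mark theta the second.
   Measures and functions on R_+ and R_+^2 are represented on R and R^2. *)
Notation plane R := (measurableTypeR R * measurableTypeR R)%type.

Section filtrations.
Context d (T : measurableType d) (R : realType).
Local Open Scope ereal_scope.
Implicit Types (P : probability T R) (G : R -> set (set T))
  (Y Z : T -> \bar R) (M : R -> T -> \bar R).

(* Time-indexed objects only matter at times t >= 0. *)
Definition is_filtration G :=
  [/\ forall t, (0 <= t)%R -> sigma_algebra setT (G t),
      forall t, (0 <= t)%R -> G t `<=` measurable &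
      forall s t, (0 <= s)%R -> (s <= t)%R -> G s `<=` G t].

Definition measurable_wrt (F : set (set T)) Z :=
  forall B : set (\bar R), measurable B -> F (Z @^-1` B).

(* Z is a version of the conditional expectation of Y given the
   sub-sigma-algebra F. *)
Definition is_cond_exp P (F : set (set T)) Y Z :=
  [/\ measurable_wrt F Z, P.-integrable setT Z &
      forall A, F A -> \int[P]_(w in A) Z w = \int[P]_(w in A) Y w].

Definition is_martingale P G M :=
  [/\ is_filtration G,
      forall t, (0 <= t)%R -> measurable_wrt (G t) (M t),
      forall t, (0 <= t)%R -> P.-integrable setT (M t) &
      forall s t, (0 <= s)%R -> (s <= t)%R -> is_cond_exp P (G s) (M t) (M s)].

Definition natural_filtration M (t : R) : set (set T) :=
  <<s [set E | exists s (B : set (\bar R)),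
    [/\ (0 <= s <= t)%R, measurable B & E = M s @^-1` B]] >>.

Definition predictable_sigma_algebra G : set (set (T * R)) :=
  <<s setT `*` `[0%R, +oo[,
    [set E | (exists2 A, G 0%R A & E = A `*` [set 0%R]) \/
      (exists s t A, [/\ (0 <= s <= t)%R, G s A & E = A `*` `]s, t]])] >>.

Definition is_predictable G M :=
  forall B : set (\bar R), measurable B ->
    predictable_sigma_algebra G
      [set z | (0 <= z.2)%R /\ B (M z.2 z.1)].

End filtrations.

Section poisson_random_measure.
Context d (T : measurableType d) (R : realType).
Local Open Scope ereal_scope.
Implicit Types (P : probability T R)
  (N : T -> {measure set (plane R) -> \bar R}).

Definition quadrant : set (plane R) := `[0%R, +oo[ `*` `[0%R, +oo[.

(* dt dtheta on R_+^2 *)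
Definition intensity (A : set (plane R)) : \bar R :=
  (lebesgue_measure \x lebesgue_measure)%E (A `&` quadrant).

(* Every realization is a locally finite integer-valued measure carried by
   the quadrant. *)
Record is_poisson_random_measure P N : Prop := {
  prm_carrier : forall w, N w (~` quadrant) = 0;
  prm_point : forall w (A : set (plane R)) (n : nat), measurable A ->
    A `<=` `[0%R, n%:R] `*` `[0%R, n%:R] -> exists k : nat, N w A = k%:R%:E;
  prm_measurable : forall A : set (plane R), measurable A ->
    measurable_fun setT (fun w => N w A);
  prm_law : forall A : set (plane R), measurable A -> intensity A < +oo ->
    forall k : nat, P [set w | N w A = k%:R%:E] =
      (expR (- fine (intensity A)) * fine (intensity A) ^+ k / k`!%:R)%:E;
  prm_indep : forall (n : nat) (A : 'I_n -> set (plane R))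
      (B : 'I_n -> set (\bar R)),
    (forall i, measurable (A i)) -> (forall i, measurable (B i)) ->
    (forall i j, i != j -> A i `&` A j = set0) ->
    P (\bigcap_(i in [set: 'I_n]) [set w | B i (N w (A i))]) =
      (\prod_(i < n) fine (P [set w | B i (N w (A i))]))%:E
}.

Definition prm_filtration N (t : R) : set (set T) :=
  <<s [set E | exists (I J : set (measurableTypeR R)) (B : set (\bar R)),
    [/\ measurable I /\ I `<=` `[0%R, t],
        measurable J /\ J `<=` `[0%R, +oo[,
        measurable B & E = (fun w => N w (I `*` J)) @^-1` B]] >>.

End poisson_random_measure.

Section stieltjes.
Context (R : realType).

Definition mk_cumulative (x : R -> R)
    (nd : {homo x : r s / r <= s}) (rc : right_continuous x) : cumulative R R :=
  HB.pack_for (cumulative R R) x (isCumulative.Build R _ R x nd rc).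

(* The Lebesgue-Stieltjes measure dx, totalized by the zero measure when x is
   not a non-decreasing right-continuous function. *)
Definition stieltjes (x : R -> R) : {measure set (measurableTypeR R) -> \bar R} :=
  match pselect ({homo x : r s / r <= s} /\ right_continuous x) with
  | left h => lebesgue_stieltjes_measure (mk_cumulative h.1 h.2)
  | right _ => mzero
  end.

(* The path jumps finitely often on compact intervals and is constant on each
   [tau_i, tau_{i+1}[ between consecutive jump times. *)
Definition piecewise_constant (x : R -> \bar R) :=
  forall S : R, 0 <= S -> exists J : seq R,
    forall a b, 0 <= a -> a <= b -> b <= S ->
      (forall r, r \in J -> ~~ (a < r <= b)) -> x a = x b.

End stieltjes.

Section hawkes.
Context d (T : measurableType d) (R : realType).
Variables (N : T -> {measure set (plane R) -> \bar R}) (mu : R) (Phi : R -> R).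
Local Open Scope ereal_scope.

(* The integral of f [:: z_1; ...; z_n] against m(dz_1) ... m(dz_n), the
   innermost one being in z_1, with times v_1 < ... < v_n < v. *)
Fixpoint iterated_integral (m : {measure set (plane R) -> \bar R}) (n : nat)
    (v : R) (f : seq (plane R) -> \bar R) : \bar R :=
  if n is n'.+1 then
    \int[m]_(z in `]0%R, v[ `*` `[0%R, +oo[)
      iterated_integral m n' z.1 (fun s => f (rcons s z))
  else f [::].

(* [s] lists (v_1, theta_1), ..., (v_n, theta_n), numbered from 0. *)
Definition hawkes_integrand (s : seq (plane R)) : R :=
  let v i := (nth (0%R : R, 0%R : R) s i).1 in
  let theta i := (nth (0%R : R, 0%R : R) s i).2 in
  ((theta 0%N <= mu)%R%:R *
   \prod_(1 <= i < size s) (theta i <= Phi (v i - v i.-1))%R%:R)%R.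

(* X^(n), for n >= 1 *)
Definition hawkes_term (n : nat) (t : R) (w : T) : \bar R :=
  \int[N w]_(z in `]0%R, t] `*` `[0%R, +oo[)
    iterated_integral (N w) n.-1 z.1 (fun s => (hawkes_integrand (rcons s z))%:E).

(* The terms are nonnegative; the sum may be +oo on a null event. *)
Definition hawkes_X (t : R) (w : T) : \bar R :=
  \sum_(1 <= n <oo) hawkes_term n t w.

(* The path is stopped at t, which does not affect the integral over ]0, t[
   and makes it depend on the path up to t only, even when the path is infinite
   at a later time. If the path is already infinite at t, the stopped path after
   [fine] gives the zero measure: the integral is then 0. *)
Definition hawkes_intensity (t : R) (w : T) : \bar R :=
  mu%:E + \int[stieltjes (fun r => fine (hawkes_X (Num.min r t) w))]_(r in `]0%R, t[)
    (Phi (t - r))%:E.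

Definition hawkes_M (t : R) (w : T) : \bar R :=
  hawkes_X t w - \int[lebesgue_measure]_(u in `]0%R, t[) hawkes_intensity u w.

End hawkes.

(* Main.v *)
Require Import Defs.
From HB Require Import structures.
From mathcomp Require Import all_boot all_order all_algebra.
From mathcomp Require Import all_classical all_reals all_analysis.
From mathcomp Require Import measurable_realfun ring.

(* Write g(z) for the number of chains z_1, ..., z_n = z of atoms of N allowed by
   the indicators. Then X_t is the integral of g over ]0, t] x R_+ against N, and
   g is predictable in time and Borel in the mark, satisfying
   g(v, theta) = 1{theta <= mu} + int_{v' < v} 1{theta <= Phi(v - v')} g(z') N(dz').
   Integrating the mark out of this identity gives the intensity:
   int g(v, theta) dtheta = mu + int_{]0,v[} Phi(v - r) dX_r = l_v as long as X is
   finite. Independence of N after s from F_s, through a monotone class argument,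
   gives Campbell's formula E int H dN = E int H dt dtheta for predictable H >= 0.
   Applied to the number of chains of length n it bounds E X^(n)_t by
   ||Phi||_1^(n-1) mu t, so E X_t < oo; applied to g on A x ]s, t] x R_+ with A in
   F_s it gives the martingale property.
   Predictability of l for the filtration of X itself holds because dX restricted
   to ]0, v[ is determined by the left limits at v of X stopped at fixed times. *)

Set Implicit Arguments.
Unset Strict Implicit.
Unset Printing Implicit Defensive.
Import Order.TTheory GRing.Theory Num.Theory.
Import numFieldNormedType.Exports.

Local Open Scope classical_set_scope.
Local Open Scope ring_scope.

(** * Measurable families of measures *)

(** The filtrations are not completed, so adaptedness and predictability must hold for every w, and
    the null event where X explodes cannot be discarded. Hence X is handled with values in the
    naturals extended by +oo. The totalization of the intensity at t depends on whether X_t is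
    finite; predictability requires that this test see only times before t, which holds because a
    path that is finite on ]0, t[ cannot become infinite at t. N is a family of measures rather than
    a kernel, and integrals against it have to be measurable for the ambient sigma-algebra, for F_t
    and for the predictable one. The tools below therefore take an arbitrary parameter space and ask
    only that the masses of sets be measurable. Independence is assumed for disjoint sets only,
    whereas F_s is generated by overlapping rectangles; these are cut into disjoint cells. One atom
    may end several chains, so g can exceed 1 and X can jump by more than 1. Slicing g by its
    integer levels turns g dN into a countable sum of restrictions of N, hence into an
    integer-valued measure. *)

Section measure_families.
Local Open Scope ereal_scope.
Context d d' (Y : measurableType d) (Z : measurableType d') (R : realType).
Implicit Types k : Y -> {measure set Z -> \bar R}.

(** Dynkin's theorem: finiteness makes the mass of a complement a difference of measurable
    functions. The total mass is a separate hypothesis because G need not contain the whole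
    space. *)
Lemma measurable_measure_of_generator (G : set (set Z)) k :
  @measurable _ Z = <<s G >> -> setI_closed G ->
  (forall y, k y setT < +oo) ->
  measurable_fun setT (k ^~ setT) ->
  (forall U, G U -> measurable_fun setT (k ^~ U)) ->
  forall U, measurable U -> measurable_fun setT (k ^~ U).
Proof.
move=> mG GI kfin kT kG U mU.
have GmU V : G V -> measurable V by rewrite mG; exact: sub_sigma_algebra.
have kfin' y V : measurable V -> k y V \is a fin_num.
  move=> mV; rewrite ge0_fin_numE//; apply: le_lt_trans (kfin y).
  by rewrite le_measure ?inE.
apply: (@dynkin_induction _ _ G (fun V => measurable_fun setT (k ^~ V))) => //.
- move=> V mV kV; rewrite (_ : k ^~ _ = (fun y => k y setT - k y V)).
    exact: emeasurable_funB.
  by apply/funext => y; rewrite -setTD measureD ?setTI//; exact: kfin.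
- move=> F mF tF kF.
  rewrite (_ : k ^~ _ = (fun y => \sum_(i <oo) k y (F i))).
    by apply: ge0_emeasurable_sum => // i _ .
  apply/funext => y; rewrite measure_bigcup//.
  by apply: eq_eseriesl => i; rewrite in_setT.
- by rewrite -mG.
Qed.

Section cover.
Variables (k : Y -> {measure set Z -> \bar R}) (E : nat -> set Z).
Hypotheses (mE : forall i, measurable (E i)) (tE : trivIset setT E)
  (covE : \bigcup_i E i = setT) (kE : forall y i, k y (E i) < +oo)
  (mk : forall U, measurable U -> measurable_fun setT (k ^~ U)).

(** A finite kernel needs a bound uniform in y, while k y (E i) is only finite for each y. Cutting
    the parameter space by the integer part of this mass gives pieces bounded by j + 1. *)
Let slice (ij : nat * nat) (y : Y) : bool :=
  (ij.2%:R%:E <= k y (E ij.1)) && (k y (E ij.1) < ij.2.+1%:R%:E).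

Let piece ij y : {measure set Z -> \bar R} :=
  if slice ij y then mrestr (k y) (mE ij.1) : {measure set Z -> \bar R}
  else mzero.

Let measurable_slice ij : measurable_fun setT (slice ij).
Proof.
apply: measurable_and; first by apply: measurable_fun_lee => //; exact: mk.
by apply: measurable_fun_lte => //; exact: mk.
Qed.

Let measurable_piece ij U : measurable U -> measurable_fun setT (piece ij ^~ U).
Proof.
move=> mU; rewrite (_ : piece ij ^~ U =
  (fun y => if slice ij y then k y (U `&` E ij.1) else 0)).
  apply: measurable_fun_ifT; [exact: measurable_slice| |exact: measurable_cst].
  by apply: mk; exact: measurableI.
by apply/funext => y; rewrite /piece; case: ifP.
Qed.

HB.instance Definition _ ij :=
  isKernel.Build _ _ Y Z R (piece ij) (@measurable_piece ij).

Let piece_uub ij : measure_fam_uub (piece ij).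
Proof.
exists ij.2.+1%:R => y; rewrite /piece; case: ifP => [/andP[_]|_].
  by rewrite /= /mrestr setTI.
by rewrite /mzero /= lte_fin ltr0n.
Qed.

HB.instance Definition _ ij :=
  Kernel_isFinite.Build _ _ Y Z R (piece ij) (piece_uub ij).

Let slice_uniq y i : exists j, forall j', slice (i, j') y = (j' == j).
Proof.
have k0 := measure_ge0 (k y) (E i).
exists (Num.truncn (fine (k y (E i)))) => j'.
rewrite /slice /= -(@fineK _ (k y (E i))) ?ge0_fin_numE//.
rewrite lee_fin lte_fin -truncn_eq ?fine_ge0//.
Qed.

Lemma sfinite_kernel_of_cover : exists K : R.-sfker Y ~> Z,
  forall y U, measurable U -> k y U = K y U.
Proof.
pose K0 i : R.-sfker Y ~> Z := kseries (fun j => piece (i, j) : R.-sfker Y ~> Z).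
exists (kseries K0) => y U mU.
rewrite /kseries /= /mseries /=.
have -> : k y U = \sum_(i <oo) k y (U `&` E i).
  rewrite -[in LHS](setIT U) -covE setI_bigcupr measure_bigcup//.
  - by apply: eq_eseriesl => i; rewrite in_setT.
  - by move=> i _; exact: measurableI.
  - exact: trivIset_setIl.
apply: eq_eseriesr => i _; rewrite /K0 /kseries /= /mseries /=.
have [j hj] := slice_uniq y i.
(* For given y and i exactly one slice is active; all other pieces are the zero measure. *)
rewrite (@nneseriesD1 _ _ j)//=.
rewrite [X in _ = _ + X]eseries0 ?adde0; last first.
  by move=> n _ /= nj; rewrite /piece hj (negbTE nj).
by rewrite /piece hj eqxx.
Qed.

(** The source of all measurability of integrals below; [Y] will carry the ambient, the adapted or
    the predictable sigma-algebra. *)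
Lemma measurable_integral_cover (f : Y * Z -> \bar R) :
  (forall yz, 0 <= f yz) -> measurable_fun setT f ->
  measurable_fun setT (fun y => \int[k y]_z f (y, z)).
Proof.
move=> f0 mf; have [K kK] := sfinite_kernel_of_cover.
rewrite (_ : (fun y => _) = (fun y => \int[K y]_z f (y, z))).
  exact: measurable_fun_integral_sfinite_kernel.
apply/funext => y; apply: eq_measure_integral => A mA _; exact: kK.
Qed.

End cover.

End measure_families.

(** * Natural numbers extended by +oo *)

Section extended_naturals.
Local Open Scope ereal_scope.
Context (R : realType).
Implicit Types (x : \bar R) (u : (\bar R)^nat).

(** The value +oo accounts for explosive paths and makes the class stable under countable sums. *)
Definition enat x := x = +oo \/ exists k : nat, x = k%:R%:E.

Lemma enat_nat k : enat k%:R%:E. Proof. by right; exists k. Qed.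

Lemma enat_ge0 x : enat x -> 0 <= x.
Proof. by move=> [->//|[k ->]]; rewrite lee_fin. Qed.

Lemma enatD x y : enat x -> enat y -> enat (x + y).
Proof.
move=> [->|[k ->]] hy; first by left; rewrite addye// gt_eqF// (lt_le_trans _ (enat_ge0 hy)).
case: hy => [->|[l ->]]; first by left; rewrite addey.
by rewrite -EFinD -natrD; exact: enat_nat.
Qed.

Lemma enat_sum u n : (forall i, enat (u i)) -> enat (\sum_(0 <= i < n) u i).
Proof.
move=> hu; elim: n => [|n IH]; first by rewrite big_nil; exact: (enat_nat 0).
by rewrite big_nat_recr//=; exact: enatD.
Qed.

(** The limit is the supremum: +oo if the sequence is unbounded, otherwise the largest of finitely
    many natural values, which is attained. *)
Lemma enat_lim u : nondecreasing_seq u -> (forall i, enat (u i)) -> enat (limn u).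
Proof.
move=> ndu hu; rewrite (cvg_lim _ (ereal_nondecreasing_cvgn ndu))//.
have [[K uK]|nb] := pselect (exists K : nat, forall i, u i <= K%:R%:E); last first.
  left; apply/eqP; rewrite -leye_eq leNgt; apply/negP => supy.
  apply: nb; exists (Num.truncn (fine (ereal_sup (range u)))).+1 => i.
  have ui : u i <= ereal_sup (range u) by apply: ereal_sup_ubound; exists i.
  have sup0 : 0 <= ereal_sup (range u) by apply: le_trans ui; exact: enat_ge0.
  apply: (le_trans ui).
  rewrite -[leLHS]fineK; last by rewrite ge0_fin_numE.
  by rewrite lee_fin ltW// truncnS_gt.
pose P k := `[< exists i, u i = k%:R%:E >].
have exP : exists k, P k.
  have [h|[k hk]] := hu 0%N; last by exists k; apply/asboolP; exists 0%N.
  by have := uK 0%N; rewrite h leye_eq.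
have ubP k : P k -> (k <= K)%N.
  by move=> /asboolP[i ik]; have := uK i; rewrite ik lee_fin ler_nat.
case: (ex_maxnP exP ubP) => m /asboolP[i uim] maxm.
right; exists m; apply/eqP; rewrite eq_le; apply/andP; split; last first.
  by rewrite -uim; apply: ereal_sup_ubound; exists i.
apply: ge_ereal_sup => _ [j _ <-].
have [h|[k hk]] := hu j; first by have := uK j; rewrite h leye_eq.
by rewrite hk lee_fin ler_nat maxm//; apply/asboolP; exists j.
Qed.

Lemma enat_series u : (forall i, enat (u i)) -> enat (\sum_(i <oo) u i).
Proof.
move=> hu; apply: enat_lim => [|n]; last exact: enat_sum.
apply: ereal_nondecreasing_series => i _ _; exact: enat_ge0.
Qed.

(** Layer-cake formula. It turns the integral of a natural-valued function into a sum of measures of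
    its level sets. *)
Lemma enat_levels x : enat x ->
  x = \sum_(j <oo) (if j.+1%:R%:E <= x then 1 else 0).
Proof.
have sum1 n : \sum_(0 <= j < n) (1 : \bar R) = n%:R%:E.
  by elim: n => [|n IH]; rewrite ?big_nil// big_nat_recr//= IH -EFinD natr1.
move=> [->|[k ->]].
  apply/esym/eqP; rewrite -leye_eq leNgt; apply/negP => soo.
  set s := \sum_(_ <oo) _ in soo.
  have s0 : 0 <= s by apply: nneseries_ge0 => i _ _; case: ifP.
  have : (Num.truncn (fine s)).+1%:R%:E <= s.
    rewrite -sum1 /s; under eq_eseriesr do rewrite leey.
    exact: nneseries_lim_ge.
  by rewrite -[leRHS]fineK ?ge0_fin_numE// lee_fin leNgt truncnS_gt.
rewrite (nneseries_split 0 k); last by move=> i _; case: ifP.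
rewrite add0n eseries0 ?adde0; last first.
  by move=> i ki _; rewrite lee_fin ler_nat leqNgt ltnS ki.
rewrite -[LHS]sum1; apply: eq_big_nat => i /andP[_ ik].
by rewrite lee_fin ler_nat ik.
Qed.

End extended_naturals.

(** * Predictable integrands *)

Section sigma_algebra_types.
Context d (T : measurableType d) (G : set (set T)).
Hypothesis sG : sigma_algebra setT G.

(** Generating from a sigma-algebra adds nothing, so G can be used as the measurable structure of a
    type. *)
Lemma measurable_sigma_algebraE (A : set (g_sigma_algebraType G)) :
  measurable A <-> G A.
Proof.
split; last exact: sub_sigma_algebra.
exact: (smallest_sub sG (@subset_refl _ G)).
Qed.

Lemma measurable_wrtP (R : realType) (f : g_sigma_algebraType G -> \bar R) :
  measurable_wrt G f <-> measurable_fun setT f.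
Proof.
split => [mf _ B mB|mf B mB].
  by rewrite setTI; apply/measurable_sigma_algebraE; exact: mf.
by apply/measurable_sigma_algebraE; rewrite -[X in _ X]setTI; exact: mf.
Qed.

End sigma_algebra_types.

Lemma measurable_fun_g_sigma d (X : measurableType d) (T : pointedType)
    (G : set (set T)) (f : X -> g_sigma_algebraType G) :
  (forall A, G A -> measurable (f @^-1` A)) -> measurable_fun setT f.
Proof.
move=> fG; apply: (@measurability _ _ _ _ setT f G) => //.
by move=> _ [A GA <-]; rewrite setTI; exact: fG.
Qed.

Section marked_predictable.
Context d (T : measurableType d) (R : realType) (G : R -> set (set T)).

(* The generator of the sigma-algebra of functions of (w, (v, theta)) that are
   predictable in (w, v) and Borel in the mark; the times v <= 0 are lumped
   together. *)
Definition mpred_gen : set (set (T * plane R)) :=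
  [set E | E = setT `*` (`]-oo, 0%R] `*` setT) \/
    exists s t A (k : nat) (J : set (measurableTypeR R)), [/\ 0 <= s, G s A, measurable J,
      J `<=` `[(- k%:R)%R, k%:R] & E = A `*` (`]s, t] `*` J)]].

Definition mpred := g_sigma_algebraType mpred_gen.

Hypothesis fG : is_filtration G.

Let sG t : 0 <= t -> sigma_algebra setT (G t).
Proof. by case: fG => h _ _; exact: h. Qed.

Let GS s t : 0 <= s -> s <= t -> G s `<=` G t.
Proof. by case: fG => _ _; exact. Qed.

Let Gm t : 0 <= t -> G t `<=` measurable.
Proof. by case: fG => _ h _; exact: h. Qed.

Let GT t : 0 <= t -> G t setT.
Proof.
by move=> /sG h; apply/(measurable_sigma_algebraE h); exact: measurableT.
Qed.

Lemma mpred_gen_measurable : mpred_gen `<=` @measurable _ (T * plane R)%type.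
Proof.
move=> _ [->|[s [t [A [k [J [s0 GA mJ _ ->]]]]]]].
  by apply: measurableX => //; apply: measurableX.
by apply: measurableX; [exact: Gm GA|apply: measurableX].
Qed.

(** The stability needed for uniqueness of measures in Campbell's formula. Two boxes meet in a box
    starting at the later of the two times, where both events are known. *)
Lemma mpred_gen_setI : setI_closed mpred_gen.
Proof.
have H0 s t A (k : nat) (J : set (measurableTypeR R)) : 0 <= s -> G s A -> measurable J ->
    J `<=` `[(- k%:R)%R, k%:R] ->
    (setT `*` (`]-oo, 0%R] `*` setT)) `&` (A `*` (`]s, t] `*` J)) = set0.
  move=> s0 _ _ _; apply/seteqP; split => // -[w [v th]] /= [[_ [+ _]] [_ [+ _]]].
  by rewrite !in_itv/= => v0 /andP[sv _]; have := lt_le_trans sv v0; rewrite ltNge s0.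
(* The empty set is the degenerate box with no marks; it covers the intersections with the
   half-plane of nonpositive times. *)
have G0 : mpred_gen set0.
  right; exists 0, 0, setT, 0%N, set0; split => //; first exact: GT.
  by rewrite !setX0.
move=> _ _ [->|[s [t [A [k [J [s0 GA mJ Jk ->]]]]]]]
  [->|[s' [t' [A' [k' [J' [s'0 GA' mJ' Jk' ->]]]]]]].
- by left; rewrite setIid.
- by rewrite (H0 _ _ _ k').
- by rewrite setIC (H0 _ _ _ k).
right; exists (Num.max s s'), (Num.min t t'), (A `&` A'), k, (J `&` J'); split.
- by rewrite le_max s0.
- have m0 : 0 <= Num.max s s' by rewrite le_max s0.
  apply/(measurable_sigma_algebraE (sG m0)); apply: measurableI.
    by apply: sub_sigma_algebra; apply: GS GA => //; rewrite le_max lexx.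
  by apply: sub_sigma_algebra; apply: GS GA' => //; rewrite le_max lexx orbT.
- exact: measurableI.
- by move=> x [] /Jk.
rewrite -!setXI; congr (_ `*` (_ `*` _)).
apply/seteqP; split => x /=; rewrite !in_itv/= gt_max le_min.
  by move=> [/andP[-> ->] /andP[-> ->]].
by move=> /andP[/andP[-> ->] /andP[-> ->]].
Qed.

Lemma mpred_measurable (A : set mpred) :
  measurable A -> @measurable _ (T * plane R)%type A.
Proof.
apply: smallest_sub; last exact: mpred_gen_measurable.
exact: sigma_algebra_measurable.
Qed.

Lemma measurable_id_mpred :
  measurable_fun setT (id : T * plane R -> mpred).
Proof. by move=> _ A mA; rewrite setTI; exact: mpred_measurable. Qed.

(** Generators have bounded marks, which keeps their mean number of atoms finite; a countable union
    removes the bound. *)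
Lemma mpred_measurable_after s A (J : set (measurableTypeR R)) (t : R) :
  0 <= s -> G s A -> measurable J ->
  @measurable _ mpred (A `*` (`]s, t] `*` J)).
Proof.
move=> s0 GA mJ.
rewrite (_ : _ `*` _ = \bigcup_k (A `*` (`]s, t] `*` (J `&` `[(- k%:R)%R, k%:R])))).
  apply: bigcupT_measurable => k; apply: sub_sigma_algebra; right.
  by exists s, t, A, k, (J `&` `[(- k%:R)%R, k%:R]); split => //; exact: measurableI.
apply/seteqP; split => [[w [v th]] /= [Aw [vst Jth]]|].
  exists (Num.truncn `|th|).+1 => //=; split => //; split => //; split => //.
  by rewrite in_itv/= -ler_norml ltW// truncnS_gt.
by move=> [w [v th]] [k _] /= [Aw [vst [Jth _]]].
Qed.

Lemma mpred_measurable_ray s A :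
  0 <= s -> G s A -> @measurable _ mpred (A `*` (`]s, +oo[ `*` setT)).
Proof.
move=> s0 GA.
rewrite (_ : _ `*` _ = \bigcup_k (A `*` (`]s, k%:R] `*` setT))).
  by apply: bigcupT_measurable => k; exact: mpred_measurable_after.
apply/seteqP; split => [[w [v th]] /= [Aw [vst _]]|].
  exists (Num.truncn v).+1 => //=; split => //; split => //.
  by move: vst; rewrite !in_itv/= andbT => ->/=; rewrite ltW// truncnS_gt.
move=> [w [v th]] [k _] /= [Aw [vst _]]; split => //; split => //.
by move: vst; rewrite !in_itv/= andbT => /andP[].
Qed.

(** The half-plane v <= 0 is not subdivided by [mpred], so time and mark are measurable only once it
    is collapsed to a point. *)
Definition positive_part_plane (z : plane R) : plane R :=
  if 0 < z.1 then z else (0, 0).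

Lemma mpred_measurable_nonpos :
  @measurable _ mpred (setT `*` (`]-oo, 0] `*` setT)).
Proof. by apply: sub_sigma_algebra; left. Qed.

Lemma measurable_mark : measurable_fun setT
  (fun y : mpred => positive_part_plane y.2).
Proof.
apply/measurable_fun_pairP; split.
  apply: (measurability _ (RGenOInfty.measurableE R)) => //.
  move=> _ [_ [a ->] <-]; rewrite setTI.
  have [a0|a0] := leP 0 a.
    rewrite (_ : _ @^-1` _ = setT `*` (`]a, +oo[ `*` setT)).
      by apply: mpred_measurable_ray => //; exact: GT.
    apply/seteqP; split => -[w [v th]] /=; rewrite /positive_part_plane /= !in_itv/= !andbT.
      by case: ifPn => //= _; rewrite ltNge a0.
    by move=> [_ [av _]]; rewrite (le_lt_trans a0 av).
  rewrite (_ : _ @^-1` _ = setT) //.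
  apply/seteqP; split => -[w [v th]] //= _; rewrite /positive_part_plane /= in_itv/= andbT.
  by case: ifPn => //=; exact: lt_trans.
move=> _ B mB; rewrite setTI.
have mB' : @measurable _ mpred (setT `*` (`]0, +oo[ `*` B)).
  rewrite (_ : _ `*` _ = \bigcup_k (setT `*` (`]0, k%:R] `*` B))).
    by apply: bigcupT_measurable => k; apply: mpred_measurable_after => //; exact: GT.
  apply/seteqP; split => [[w [v th]] /= [Aw [vst Bth]]|].
    exists (Num.truncn v).+1 => //=; split => //; split => //.
    by move: vst; rewrite !in_itv/= andbT => ->/=; rewrite ltW// truncnS_gt.
  move=> [w [v th]] [k _] /= [Aw [vst Bth]]; split => //; split => //.
  by move: vst; rewrite !in_itv/= andbT => /andP[].
have [B0|B0] := pselect (B 0).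
  rewrite (_ : _ @^-1` _ = setT `*` (`]0, +oo[ `*` B) `|`
                           setT `*` (`]-oo, 0] `*` setT)).
    by apply: measurableU => //; exact: mpred_measurable_nonpos.
  apply/seteqP; split => -[w [v th]] /=; rewrite /positive_part_plane !in_itv/= !andbT.
    by case: ifPn => /= v0 Bth; [left|right; rewrite -leNgt in v0].
  by case => -[_ []]; [move=> ->|rewrite leNgt => /negbTE ->].
rewrite (_ : _ @^-1` _ = setT `*` (`]0, +oo[ `*` B)) //.
apply/seteqP; split => -[w [v th]] /=; rewrite /positive_part_plane !in_itv/= !andbT.
  by case: ifPn.
by move=> [_ [-> Bth]].
Qed.

(* The value of a predictable process on ]0, t] only depends on G t. *)
Lemma measurable_before t : 0 <= t ->
  measurable_fun setT (fun x : g_sigma_algebraType (G t) * plane R =>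
    (x.1, if 0 < x.2.1 <= t then x.2 else (0, 0)) : mpred).
Proof.
move=> t0.
apply: measurable_fun_g_sigma => _ [->|[s [t' [A [k [J [s0 GA mJ Jk ->]]]]]]].
  (* The default point (0, 0) lies in the lumped half-plane, so its preimage is everything outside
     the times ]0, t]. *)
  rewrite (_ : _ @^-1` _ = ~` (setT `*` (`]0, t] `*` setT))).
    by apply: measurableC; apply: measurableX => //; exact: measurableX.
  apply/seteqP; split => -[w [v th]] /=; rewrite !in_itv/=.
    case: ifPn => /= [/andP[v0 _] [_ [+ _]]|vt _ [_ []]]; first by rewrite leNgt v0.
    by [].
  case: ifPn => //= vt; first by move=> h; exfalso; apply: h.
(* If t <= s, no time in ]0, t] exceeds s; otherwise A belongs to G s, hence to G t. *)
have [st|ts] := ltP s t; last first.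
  rewrite (_ : _ @^-1` _ = set0) //; apply/seteqP; split => -[w [v th]] //=.
  case: ifPn => //=; rewrite !in_itv/=.
    by move=> /andP[_ vt] [_ [/andP[sv _] _]]; have := lt_le_trans sv vt; rewrite ltNge ts.
  by move=> _ [_ [/andP[]]]; rewrite ltNge s0.
rewrite (_ : _ @^-1` _ = A `*` (`]s, Num.min t t'] `*` J)).
  apply: measurableX; last exact: measurableX.
  by apply: sub_sigma_algebra; apply: GS GA => //; exact: ltW.
apply/seteqP; split => -[w [v th]] /=; rewrite !in_itv/=.
  case: ifPn => /= [/andP[v0 vt]|_].
    by rewrite le_min vt.
  by move=> [_ [/andP[]]]; rewrite ltNge s0.
rewrite le_min => -[Aw [/and3P[sv vt vt'] Jth]].
by rewrite (le_lt_trans s0 sv) vt /= sv vt'.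
Qed.

(* A predictable process at an earlier time v' < v is predictable in v. *)
Lemma measurable_earlier :
  measurable_fun setT (fun x : mpred * plane R =>
    (x.1.1, if 0 < x.2.1 < x.1.2.1 then x.2 else (0, 0)) : mpred).
Proof.
(* The current time v is not measurable on [mpred], but its collapsed version is, and both agree
   when 0 < v' < v. *)
have mlt : measurable [set x : mpred * plane R | x.2.1 < (positive_part_plane x.1.2).1].
  rewrite -[X in measurable X]setTI; apply: measurable_fun_ltr => //.
  - exact: measurableT_comp measurable_fst measurable_snd.
  - apply: measurableT_comp measurable_fst _.
    exact: measurableT_comp measurable_mark measurable_fst.
apply: measurable_fun_g_sigma => _ [->|[s [t' [A [k [J [s0 GA mJ Jk ->]]]]]]].
  rewrite (_ : _ @^-1` _ = ~` ((setT `*` (`]0, +oo[ `*` setT)) `&`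
     [set x : mpred * plane R | x.2.1 < (positive_part_plane x.1.2).1])).
    apply: measurableC; apply: measurableI => //.
    by apply: measurableX => //; exact: measurableX.
  apply/seteqP; split => -[[w [v th]] [v' th']] /=;
    rewrite !in_itv/= !andbT /positive_part_plane /=.
    case: ifPn => /= [/andP[v0 v'v]|].
      by rewrite leNgt v0 => -[_ []].
    move=> h _ [[_ [v'0 _]]]; case: ifPn => /= [v0 v'v|_].
      by move: h; rewrite v'0 v'v.
    by rewrite ltNge (ltW v'0).
  have [/andP[v0 v'v] h|//] := boolP (0 < v' < v); exfalso; apply: h.
  by rewrite v0 (lt_trans v0 v'v).
(* From s < v' < v follows v > s: the event A, known at time s, is used at the later time v. *)
rewrite (_ : _ @^-1` _ = ((A `*` (`]s, +oo[ `*` setT)) `*` (`]s, t'] `*` J)) `&`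
     [set x : mpred * plane R | x.2.1 < (positive_part_plane x.1.2).1]).
  apply: measurableI => //; apply: measurableX; last exact: measurableX.
  exact: mpred_measurable_ray.
apply/seteqP; split => -[[w [v th]] [v' th']] /=;
    rewrite !in_itv/= !andbT /positive_part_plane /=.
  case: ifPn => /= [/andP[v'0 v'v] [Aw [/andP[sv' v't] Jth]]|_].
    by rewrite (lt_trans v'0 v'v) (lt_trans sv' v'v) sv' v't.
  by move=> [_ [/andP[]]]; rewrite ltNge s0.
move=> [[[Aw [sv _]] [/andP[sv' v't] Jth]]].
rewrite (le_lt_trans s0 sv) /= => v'v.
by rewrite v'v (le_lt_trans s0 sv') /= sv' v't.
Qed.


Local Open Scope ereal_scope.

(** The left limit of a nondecreasing adapted process is a supremum over rational q of the processes
    equal to a_q on ]q, +oo[ and to 0 before. Each of them is predictable. The added 0 is the value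
    when no time precedes v. *)
Lemma measurable_left_limit (a : R -> T -> \bar R) (b : mpred -> \bar R) :
  (forall q, (0 <= q)%R -> measurable_wrt (G q) (a q)) ->
  (forall q w, 0 <= a q w) ->
  (forall w q r, (0 <= q)%R -> (q <= r)%R -> a q w <= a r w) ->
  (forall y, b y = ereal_sup (0 |` [set a q y.1 | q in `[0%R, y.2.1[])) ->
  measurable_fun setT b.
Proof.
move=> ma a0 nda bE.
(* An enumeration of the rationals; codes that decode to nothing give 0. *)
pose q_ (n : nat) : R := ratr (odflt 0%R (unpickle n : option rat)).
pose f n (y : mpred) : \bar R :=
  if (0 <= q_ n < y.2.1)%R then a (q_ n) y.1 else 0.
have mf n : measurable_fun setT (f n).
  have [q0|q0] := boolP (0 <= q_ n)%R; last first.
    rewrite (_ : f n = cst 0); first exact: measurable_cst.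
    by apply/funext => y; rewrite /f (negbTE q0).
  apply: (measurability _ (ErealGenOInfty.measurableE R)) => // _ [_ [x ->] <-].
  rewrite setTI; have [x0|x0] := ltP x 0%R.
    rewrite (_ : _ @^-1` _ = setT); first exact: measurableT.
    apply/seteqP; split => // y _ /=; rewrite /f in_itv/= andbT.
    have h0 : x%:E < 0 by rewrite lte_fin.
    by case: ifP => _ //; exact: lt_le_trans h0 _.
  rewrite (_ : _ @^-1` _ =
      (a (q_ n) @^-1` `]x%:E, +oo[) `*` (`]q_ n, +oo[ `*` setT)).
    apply: mpred_measurable_ray => //; apply: ma => //; exact: emeasurable_itv.
  apply/seteqP; split => -[w [v th]] /=; rewrite /f /= !in_itv/= !andbT.
    case: ifPn => [/andP[_ ->]//|_].
    by rewrite lte_fin ltNge x0.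
  by rewrite q0 => -[xa [-> _]].
rewrite (_ : b = fun y => esups (f ^~ y) 0%N); first exact: measurable_fun_esups.
apply/funext => y; rewrite bE /esups /sdrop /=; apply/eqP; rewrite eq_le; apply/andP; split.
  apply: ge_ereal_sup => x [->|[q /=]].
    apply: (@le_trans _ _ (f 0%N y)); last by apply: ereal_sup_ubound; exists 0%N.
    by rewrite /f; case: ifP.
  rewrite in_itv/= => /andP[q0 qv] <-.
  have [r /itvP rqv] := rat_in_itvoo qv.
  apply: (@le_trans _ _ (f (pickle r) y)); last by apply: ereal_sup_ubound; exists (pickle r).
  rewrite /f /q_ pickleK /= (le_trans q0) ?rqv//= nda// ?rqv//.
apply: ge_ereal_sup => _ [n _ <-]; rewrite /f; case: ifPn => [/andP[q0 qv]|_].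
  by apply: ereal_sup_ubound; right; exists (q_ n) => //=; rewrite in_itv/= q0.
by apply: ereal_sup_ubound; left.
Qed.

End marked_predictable.

Section continuity_from_below.
Local Open Scope ereal_scope.
Context d (Z : measurableType d) (R : realType) (m : {measure set Z -> \bar R}).
Variables (f : Z -> R) (U : set Z).
Hypotheses (mf : measurable_fun setT f) (mU : measurable U).

Let mI (i : interval R) : measurable (U `&` f @^-1` [set` i]).
Proof.
apply: measurableI => //; rewrite -[X in measurable X]setTI; apply: mf => //.
Qed.

(** Continuity from below, in the shape that [measurable_left_limit] asks for. *)
Lemma measure_left_limit (v : R) :
  m (U `&` f @^-1` `]0%R, v[) =
  ereal_sup (0 |` [set m (U `&` f @^-1` `]0%R, q]) | q in `[0%R, v[]).
Proof.
apply/eqP; rewrite eq_le; apply/andP; split; last first.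
  apply: ge_ereal_sup => x [->|[q]]; first exact: measure_ge0.
  rewrite /= in_itv/= => /andP[q0 qv] <-.
  apply: le_measure; rewrite ?inE; [exact: mI|exact: mI|].
  by move=> z [Uz] /=; rewrite !in_itv/= => /andP[-> /le_lt_trans ->].
have [v0|v0] := leP v 0%R.
  rewrite set_itv_ge ?bnd_simp -?leNgt// preimage_set0 setI0 measure0.
  by apply: ereal_sup_ubound; left.
(* A nondecreasing sequence from 0 to v that stays in [0, v[. *)
pose c (n : nat) : R := (v - v / n.+1%:R)%R.
have cv n : (c n < v)%R by rewrite ltrBlDr ltrDl divr_gt0.
have c0 n : (0 <= c n)%R.
  by rewrite subr_ge0 ler_pdivrMr// ler_peMr ?(ltW v0)// ler1n.
have cc n k : (n <= k)%N -> (c n <= c k)%R.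
  move=> nk; rewrite lerD2l lerN2 ler_pM2l// lef_pV2 ?posrE ?ltr0n//.
  by rewrite ler_nat ltnS.
have cU : \bigcup_n (U `&` f @^-1` `]0%R, c n]) = U `&` f @^-1` `]0%R, v[.
  apply/seteqP; split => [z [n _] [Uz] /=|z [Uz] /=]; rewrite !in_itv/=.
    by move=> /andP[-> /le_lt_trans ->]//.
  move=> /andP[z0 zv].
  exists (Num.truncn (v / (v - f z))) => //; split => //=; rewrite in_itv/= z0/=.
  have vz : (0 < v - f z)%R by rewrite subr_gt0.
  rewrite /c lerBrDr -lerBrDl ler_pdivrMr ?ltr0n// mulrC -ler_pdivrMr//.
  by rewrite ltW// truncnS_gt.
have ndc n k : (n <= k)%N -> U `&` f @^-1` `]0%R, c n] `<=` U `&` f @^-1` `]0%R, c k].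
  move=> nk z [Uz] /=; rewrite !in_itv/= => /andP[-> /=].
  by move=> h; split => //; exact: le_trans h (cc _ _ nk).
have := @nondecreasing_cvg_mu _ _ _ m (fun n => U `&` f @^-1` `]0%R, c n]).
rewrite cU => /(_ _ _ _)/cvg_lim <-//; last first.
- by move=> n k nk; apply/subsetPset; exact: ndc.
- apply: lime_le.
    apply: ereal_nondecreasing_is_cvgn => n k nk.
    apply: le_measure; rewrite ?inE; [exact: mI|exact: mI|].
    exact: ndc.
  apply: nearW => n; apply: ereal_sup_ubound; right; exists (c n) => //=.
  by rewrite in_itv/= c0 cv.
Qed.

End continuity_from_below.

(** * Adaptedness of the Poisson random measure *)

(** Moves the domain into the measure, so that a domain depending on a parameter becomes part of a
    family of measures. *)
Lemma integral_mrestr d (Z : measurableType d) (R : realType)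
    (m : {measure set Z -> \bar R}) (D : set Z) (mD : measurable D)
    (f : Z -> \bar R) : (forall z, (0 <= f z)%E) -> measurable_fun setT f ->
  (\int[mrestr m mD]_z f z = \int[m]_(z in D) f z)%E.
Proof.
move=> f0 mf; rewrite -(setUv D) ge0_integral_setU//=.
- rewrite [X in (_ + X)%E]null_set_integral ?adde0.
  + by apply: eq_measure_integral => A _ AD; rewrite /= /mrestr setIidl.
  + exact: measurableC.
  + exact: measurable_funS mf.
  + by rewrite /= /mrestr setICl measure0.
- exact: measurableC.
- by rewrite setUv.
- by apply/disj_setPS; rewrite setICr.
Qed.

Section poisson.
Context d (T : measurableType d) (R : realType) (P : probability T R).
Variable N : T -> {measure set (plane R) -> \bar R}.
Hypothesis N_poisson : is_poisson_random_measure P N.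
Local Open Scope ereal_scope.

Lemma prm_filtrationP : is_filtration (prm_filtration N).
Proof.
split => [t _|t _|s t s0 st].
- exact: smallest_sigma_algebra.
- apply: smallest_sub; first exact: sigma_algebra_measurable.
  move=> _ [I [J [B [[mI _] [mJ _] mB ->]]]].
  rewrite -[X in measurable X]setTI; apply: (prm_measurable N_poisson) => //.
  exact: measurableX.
- apply: sub_smallest2r; first exact: smallest_sigma_algebra.
  move=> _ [I [J [B [[mI It] J0 mB ->]]]].
  exists I, J, B; split => //; split => // x /It /=.
  by rewrite !in_itv/= => /andP[-> /le_trans]; exact.
Qed.

Definition square (n : nat) : set (plane R) :=
  `[0%R, n%:R] `*` `[0%R, n%:R].

Lemma measurable_square n : measurable (square n).
Proof. exact: measurableX. Qed.

Lemma measurable_quadrant : measurable (@quadrant R).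
Proof. exact: measurableX. Qed.

Lemma bigcup_square : \bigcup_n square n = @quadrant R.
Proof.
apply/seteqP; split => [[x y] [n _]|[x y]]; rewrite /square /quadrant /= !in_itv/= ?andbT.
  by move=> [/andP[-> _] /andP[-> _]].
move=> [x0 y0]; exists (Num.truncn (Num.max x y)).+1 => //=.
have := truncnS_gt (Num.max x y); rewrite gt_max => /andP[/ltW hx /ltW hy].
by rewrite !in_itv/= x0 y0 hx hy.
Qed.

Lemma square_nd n k : (n <= k)%N -> square n `<=` square k.
Proof.
move=> nk [x y]; rewrite /square /= !in_itv/= => -[/andP[-> xn] /andP[-> yn]].
by rewrite (le_trans xn) ?ler_nat// (le_trans yn) ?ler_nat.
Qed.

Lemma prm_square_enat w n (A : set (plane R)) : measurable A ->
  exists k : nat, N w (A `&` square n) = k%:R%:E.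
Proof.
move=> mA; apply: (prm_point N_poisson w (n := n)); last exact: subIsetr.
by apply: measurableI => //; exact: measurable_square.
Qed.

Lemma prm_setI_quadrant w (A : set (plane R)) : measurable A ->
  N w A = N w (A `&` @quadrant R).
Proof.
move=> mA; rewrite -[in LHS](setIT A) -(setUv (@quadrant R)) setIUr measureU.
- rewrite [X in _ + X](_ : _ = 0) ?adde0//; apply/eqP.
  rewrite eq_le measure_ge0 andbT -(prm_carrier N_poisson w).
  apply: le_measure; rewrite ?inE; last exact: subIsetr.
    by apply: measurableI => //; apply: measurableC; exact: measurable_quadrant.
  by apply: measurableC; exact: measurable_quadrant.
- by apply: measurableI => //; exact: measurable_quadrant.
- by apply: measurableI => //; apply: measurableC; exact: measurable_quadrant.
- by rewrite setIACA setICr setI0.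
Qed.

Lemma prm_cvg_square w (A : set (plane R)) : measurable A ->
  N w (A `&` square n) @[n --> \oo] --> N w A.
Proof.
move=> mA; rewrite [X in _ --> X]prm_setI_quadrant// -bigcup_square setI_bigcupr.
apply: nondecreasing_cvg_mu.
- by move=> n; apply: measurableI => //; exact: measurable_square.
- by apply: bigcupT_measurable => n; apply: measurableI => //; exact: measurable_square.
- by move=> n k nk; apply/subsetPset; apply: setIS; exact: square_nd.
Qed.

Lemma prm_enat w (A : set (plane R)) : measurable A -> enat (N w A).
Proof.
move=> mA; rewrite -(cvg_lim _ (@prm_cvg_square w A mA))//; apply: enat_lim.
  move=> n k nk; apply: le_measure; rewrite ?inE; last first.
  - by apply: setIS; exact: square_nd.
  - by apply: measurableI => //; exact: measurable_square.
  - by apply: measurableI => //; exact: measurable_square.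
by move=> n; right; exact: prm_square_enat.
Qed.

Let cover0 n : set (plane R) := if n is n'.+1 then square n' else ~` @quadrant R.

(** One cover serves every w: squares have finite integer mass and the complement of the quadrant
    has none. [seqDU] makes them disjoint. *)
Lemma prm_cover : exists E : nat -> set (plane R),
  [/\ forall i, measurable (E i), trivIset setT E, \bigcup_i E i = setT &
      forall w i, N w (E i) < +oo].
Proof.
have m0 n : measurable (cover0 n).
  case: n => [|n] /=; last exact: measurable_square.
  by apply: measurableC; exact: measurable_quadrant.
have mE i : measurable (seqDU cover0 i).
  by apply: measurableD => //; exact: bigsetU_measurable.
exists (seqDU cover0); split => //.
  rewrite -seqDU_bigcup_eq; apply/seteqP; split => // z _.
  have [qz|qz] := pselect ((@quadrant R) z); last by exists 0%N.
  by move: qz; rewrite -bigcup_square => -[n _ nz]; exists n.+1.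
move=> w i; apply: (@le_lt_trans _ _ (N w (cover0 i))).
  apply: le_measure; rewrite ?inE//; exact: subDsetl.
case: i => [|i] /=; first by rewrite (prm_carrier N_poisson).
have [k] := prm_square_enat w i measurableT.
by rewrite setTI => ->; rewrite ltry.
Qed.

Definition strip (i : interval R) : set (plane R) := [set` i] `*` `[0%R, +oo[.

Lemma measurable_strip i : measurable (strip i).
Proof. exact: measurableX. Qed.

(** F_t is generated by counts of rectangles; a monotone class argument passes to Borel sets. As it
    needs finite measures, marks are first cut at k, and then k tends to infinity. *)
Lemma prm_adapted t U : (0 <= t)%R -> measurable U ->
  measurable_wrt (prm_filtration N t) (fun w => N w (U `&` strip `]0%R, t])).
Proof.
move=> t0 mU; have [sF _ _] := prm_filtrationP.
apply/(measurable_wrtP (sF t t0)).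
pose D k := (`]0%R, t] `*` `[0%R, k%:R] : set (plane R)).
have mD k : measurable (D k) by exact: measurableX.
pose F := g_sigma_algebraType (prm_filtration N t).
pose kk k (w : F) : {measure set (plane R) -> \bar R} := mrestr (N w) (mD k).
(* A rectangle cut to times ]0, t] and marks [0, k] is again a rectangle among the generators of
   F_t. *)
have mrect k I J : measurable I -> measurable J ->
    measurable_fun setT (fun w : F => kk k w (I `*` J)).
  move=> mI mJ; apply/(measurable_wrtP (sF t t0)) => B mB.
  apply: sub_sigma_algebra; exists (I `&` `]0%R, t]), (J `&` `[0%R, k%:R]), B.
  split => //.
  - split; first exact: measurableI.
    by move=> x [_] /=; rewrite !in_itv/= => /andP[/ltW -> ->].
  - split; first exact: measurableI.
    by move=> x [_] /=; rewrite !in_itv/= => /andP[-> _].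
  - by rewrite /kk /= /mrestr /D -setXI.
apply: (@emeasurable_fun_cvg _ _ _ setT (fun k w => kk k w U)).
  move=> k.
  apply: (@measurable_measure_of_generator _ _ F _ _
    [set A `*` B | A in measurable & B in measurable]) => //.
  - by rewrite measurable_prod_measurableType.
  - move=> _ _ [A mA [B mB <-]] [A' mA' [B' mB' <-]].
    exists (A `&` A'); first exact: measurableI.
    by exists (B `&` B'); [exact: measurableI|rewrite setXI].
  - move=> w; rewrite /kk /= /mrestr setTI.
    apply: (@le_lt_trans _ _ (N w (setT `&` square (maxn k (Num.truncn t).+1)))).
      apply: le_measure; rewrite ?inE//.
        by rewrite setTI; exact: measurable_square.
      rewrite setTI => -[x y]; rewrite /D /square /= !in_itv/=.
      move=> [/andP[x0 xt] /andP[y0 yk]]; split; apply/andP; split => //.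
      - exact: ltW.
      - by rewrite (le_trans xt)// (le_trans (ltW (truncnS_gt _)))// ler_nat leq_maxr.
      - by rewrite (le_trans yk)// ler_nat leq_maxl.
    by have [j ->] := prm_square_enat w (maxn k (Num.truncn t).+1) measurableT; rewrite ltry.
  - by rewrite -setXTT; exact: mrect.
  - by move=> _ [A mA [B mB <-]]; exact: mrect.
move=> w _; rewrite /kk /= /mrestr.
rewrite (_ : U `&` _ = \bigcup_k (U `&` D k)); last first.
  rewrite -setI_bigcupr; congr (_ `&` _); apply/seteqP; split => [[x y]|[x y] [k _]].
    rewrite /strip /= => -[xt]; rewrite in_itv/= andbT => y0.
    exists (Num.truncn y).+1 => //; split => //=.
    by rewrite in_itv/= y0 ltW// truncnS_gt.
  by rewrite /D /strip /= !in_itv/= => -[-> /andP[->]].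
apply: nondecreasing_cvg_mu.
- by move=> k; exact: measurableI.
- by apply: bigcupT_measurable => k; exact: measurableI.
- move=> n k nk; apply/subsetPset; apply: setIS => -[x y]; rewrite /D /= !in_itv/=.
  by move=> [-> /andP[-> yn]]; split => //; rewrite (le_trans yn)// ler_nat.
Qed.


Section integral_measurability.
Variable (D : measure_display) (Y : measurableType D).
Variables (pr : Y -> T) (S : Y -> set (plane R)).
Hypotheses (mS : forall y, measurable (S y))
  (mN : forall U, measurable U -> measurable_fun setT (fun y => N (pr y) (U `&` S y))).

(** The parameter y determines both the outcome [pr y] and the domain [S y]; the three lemmas that
    follow instantiate it with the three sigma-algebras. *)
Lemma measurable_integral_prm (f : Y * plane R -> \bar R) :
  (forall yz, 0 <= f yz) -> measurable_fun setT f ->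
  measurable_fun setT (fun y => \int[N (pr y)]_(z in S y) f (y, z)).
Proof.
move=> f0 mf.
have [E [mE tE cE Noo]] := prm_cover.
pose k y : {measure set (plane R) -> \bar R} := mrestr (N (pr y)) (mS y).
rewrite (_ : (fun y => _) = (fun y => \int[k y]_z f (y, z))); last first.
  by apply/funext => y; rewrite integral_mrestr//; exact: measurableT_comp.
apply: (measurable_integral_cover mE tE cE) => // y i.
apply: le_lt_trans (Noo (pr y) i).
by apply: le_measure; rewrite ?inE//; exact: measurableI.
Qed.

End integral_measurability.

Lemma measurable_integral_prmT (f : T * plane R -> \bar R) (S : set (plane R)) :
  measurable S -> (forall x, 0 <= f x) -> measurable_fun setT f ->
  measurable_fun setT (fun w => \int[N w]_(z in S) f (w, z)).
Proof.
move=> mS f0 mf; apply: (@measurable_integral_prm _ T id (fun=> S)) => // U mU.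
by apply: (prm_measurable N_poisson); exact: measurableI.
Qed.

Lemma measurable_integral_prm_before t
    (f : g_sigma_algebraType (prm_filtration N t) * plane R -> \bar R) :
  (0 <= t)%R -> (forall x, 0 <= f x) -> measurable_fun setT f ->
  measurable_wrt (prm_filtration N t)
    (fun w => \int[N w]_(z in strip `]0%R, t]) f (w, z)).
Proof.
move=> t0 f0 mf; have [sF _ _] := prm_filtrationP.
apply/(measurable_wrtP (sF t t0)).
apply: (@measurable_integral_prm _ (g_sigma_algebraType (prm_filtration N t)) id
  (fun=> strip `]0%R, t])) => //.
  by move=> _; exact: measurable_strip.
by move=> U mU; apply/(measurable_wrtP (sF t t0)); exact: prm_adapted.
Qed.

(** The counts on ]0, v[ are left limits at v of the adapted counts on ]0, q], hence predictable. *)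
Lemma measurable_integral_prm_left
    (f : mpred (prm_filtration N) * plane R -> \bar R) :
  (forall x, 0 <= f x) -> measurable_fun setT f ->
  measurable_fun setT (fun y : mpred (prm_filtration N) =>
    \int[N y.1]_(z in strip `]0%R, y.2.1[) f (y, z)).
Proof.
move=> f0 mf.
apply: (@measurable_integral_prm _ (mpred (prm_filtration N)) fst
  (fun y => strip `]0%R, y.2.1[)) => //.
  by move=> y; exact: measurable_strip.
move=> U mU.
have stripE i : U `&` strip i = (U `&` (setT `*` `[0%R, +oo[)) `&` fst @^-1` [set` i].
  by apply/seteqP; split => -[x y] /=; rewrite /strip /=; tauto.
have mU' : measurable (U `&` (setT `*` `[0%R, +oo[) : set (plane R)).
  by apply: measurableI => //; exact: measurableX.
apply: (@measurable_left_limit _ _ _ _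
  (fun q w => N w (U `&` strip `]0%R, q]))
  (fun y => N y.1 (U `&` strip `]0%R, y.2.1[))).
- by move=> q q0; exact: prm_adapted.
- by [].
- move=> w q r q0 qr; apply: le_measure; rewrite ?inE.
  + by apply: measurableI => //; exact: measurable_strip.
  + by apply: measurableI => //; exact: measurable_strip.
  + apply: setIS => -[x y] [] /=; rewrite /strip /= !in_itv/= => /andP[-> xq] ->.
    by rewrite (le_trans xq qr).
- move=> [w [v th]] /=; rewrite stripE measure_left_limit//.
  by congr (ereal_sup (_ `|` _)); apply/seteqP;
    split => _ [q qv <-]; exists q => //=; rewrite stripE.
Qed.

End poisson.

(** * Chains of atoms *)

Section hawkes_weights.
Context d (T : measurableType d) (R : realType) (P : probability T R).
Variable N : T -> {measure set (plane R) -> \bar R}.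
Hypothesis N_poisson : is_poisson_random_measure P N.
Variables (mu : R) (Phi : R -> R).
Hypothesis Phi_meas : measurable_fun (`[0, +oo[%classic : set (measurableTypeR R)) Phi.
Local Open Scope ereal_scope.

Lemma iterated_integral0 m n v (f : seq (plane R) -> \bar R) :
  (forall s, f s = 0) -> iterated_integral m n v f = 0.
Proof.
elim: n v f => [|n IH] v f f0 //=; apply: integral0_eq => z _; exact: IH.
Qed.

(** A factor that is 0 or 1 leaves the integral without any measurability of f. *)
Lemma iterated_integral_indicator m n v (b : bool) (f : seq (plane R) -> \bar R) :
  iterated_integral m n v (fun s => b%:R%:E * f s) =
  b%:R%:E * iterated_integral m n v f.
Proof.
case: b; first by rewrite mul1e; congr iterated_integral; apply/funext => s; rewrite mul1e.
by rewrite mul0e; apply: iterated_integral0 => s; rewrite mul0e.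
Qed.

(** Phi is measurable on R_+ only; extension by 0 gives a Borel function on R. *)
Definition kernel_pos : R -> R := Phi \_ `[0%R, +oo[.

Lemma kernel_posE x : (0 <= x)%R -> kernel_pos x = Phi x.
Proof. by move=> x0; rewrite /kernel_pos patchE mem_set//= in_itv/= x0. Qed.

Lemma measurable_kernel_pos : measurable_fun setT kernel_pos.
Proof. exact/(measurable_restrictT _ _).1. Qed.

(* [hawkes_weight n (w, z)] counts the chains of n + 1 atoms of N w, the last
   of which is z. *)
Fixpoint hawkes_weight (n : nat) (y : T * plane R) : \bar R :=
  if n is n'.+1 then
    \int[N y.1]_(z in strip `]0%R, y.2.1[)
      ((y.2.2 <= kernel_pos (y.2.1 - z.1))%R%:R%:E * hawkes_weight n' (y.1, z))
  else if (0 < y.2.1)%R then (y.2.2 <= mu)%R%:R%:E else 0.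

Lemma hawkes_weight_ge0 n y : 0 <= hawkes_weight n y.
Proof.
elim: n y => [|n IH] y /=; first by case: ifP => // _; rewrite lee_fin.
by apply: integral_ge0 => z _; rewrite mule_ge0// lee_fin.
Qed.

(** The appended atom enters only the last factor of the product, through its distance to the
    preceding atom. *)
Lemma hawkes_integrand_rcons (s : seq (plane R)) (z' z : plane R) :
  hawkes_integrand mu Phi (rcons (rcons s z') z) =
  ((z.2 <= Phi (z.1 - z'.1))%R%:R * hawkes_integrand mu Phi (rcons s z'))%R.
Proof.
rewrite /hawkes_integrand !size_rcons big_nat_recr//= !nth_rcons !size_rcons.
rewrite !ltnn !eqxx ltnSn /= mulrA [RHS]mulrC; congr (_ * _ * _)%R.
apply: eq_big_nat => i /andP[i0 si].
have nthE j : (j < (size s).+1)%N ->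
    nth (0%R, 0%R) (rcons (rcons s z') z) j = nth (0%R, 0%R) (rcons s z') j.
  by move=> js; rewrite (nth_rcons _ (rcons s z')) size_rcons /= js.
by rewrite !nthE// (leq_ltn_trans (leq_pred _)).
Qed.

(** The outermost remaining integration is over the atom just before z, so iterated integral and
    [hawkes_weight] unfold from the same end of the chain. *)
Lemma iterated_hawkes_integrand w n (z : plane R) : (0 < z.1)%R ->
  iterated_integral (N w) n z.1
    (fun s => (hawkes_integrand mu Phi (rcons s z))%:E) = hawkes_weight n (w, z).
Proof.
elim: n z => [|n IH] z z0 /=.
  by rewrite /hawkes_integrand /= big_geq// mulr1 z0.
apply: eq_integral => z'; rewrite inE => -[/= z'z _].
move: z'z; rewrite in_itv/= => /andP[z'0 z'z].
under [X in iterated_integral _ _ _ X]funext => s do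
  rewrite hawkes_integrand_rcons EFinM.
by rewrite iterated_integral_indicator IH// kernel_posE// subr_ge0 ltW.
Qed.

Lemma hawkes_termE n t w : hawkes_term N mu Phi n.+1 t w =
  \int[N w]_(z in strip `]0%R, t]) hawkes_weight n (w, z).
Proof.
apply: eq_integral => z; rewrite inE => -[/= + _].
rewrite in_itv/= => /andP[z0 _]; exact: iterated_hawkes_integrand.
Qed.

Local Notation Y := (mpred (prm_filtration N)).

Lemma measurable_hawkes_weight n :
  measurable_fun setT (hawkes_weight n : Y -> \bar R).
Proof.
have [sF _ _] := prm_filtrationP N_poisson.
have mm := measurable_mark (prm_filtrationP N_poisson).
elim: n => [|n IH].
  have -> : hawkes_weight 0 = (fun y : Y =>
      if (0 < (positive_part_plane y.2).1)%R then
      (((positive_part_plane y.2).2 <= mu)%R%:R)%:E else 0).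
    apply/funext => -[w [v th]]; rewrite /= /positive_part_plane /=.
    by case: ifPn => /=; [move=> ->|rewrite ltxx].
  apply: measurable_fun_ifT => //.
    apply: measurable_fun_ltr => //; exact: measurableT_comp measurable_fst mm.
  apply/measurable_EFinP.
  apply: (measurableT_comp (f := fun b : bool => (b%:R : R))) => //.
  apply: measurable_fun_ler => //; exact: measurableT_comp measurable_snd mm.
(* The integrand with time, mark and earlier atom replaced by their collapsed versions: measurable
   everywhere, and unchanged for 0 < z.1 < v. *)
pose f (x : Y * plane R) : \bar R :=
  ((positive_part_plane x.1.2).2 <=
    kernel_pos ((positive_part_plane x.1.2).1 - x.2.1))%R%:R%:E *
  hawkes_weight n ((x.1.1, if (0 < x.2.1 < x.1.2.1)%R then x.2 else (0%R, 0%R)) : Y).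
have -> : hawkes_weight n.+1 = (fun y : Y =>
    \int[N y.1]_(z in strip `]0%R, y.2.1[) f (y, z)).
  apply/funext => -[w [v th]] /=; apply: eq_integral => z; rewrite inE => -[/= + _].
  rewrite in_itv/= => /andP[z0 zv]; rewrite /f /= /positive_part_plane /=.
  by rewrite (lt_trans z0 zv) z0 zv.
have mf : measurable_fun setT f.
  apply: emeasurable_funM.
    apply/measurable_EFinP.
    apply: (measurableT_comp (f := fun b : bool => (b%:R : R))) => //.
    apply: measurable_fun_ler.
      apply: measurableT_comp measurable_snd _.
      exact: measurableT_comp mm measurable_fst.
    apply: measurableT_comp measurable_kernel_pos _.
    apply: measurable_funB.
      apply: measurableT_comp measurable_fst _.
      exact: measurableT_comp mm measurable_fst.
    exact: measurableT_comp measurable_fst measurable_snd.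
  apply: (measurableT_comp IH).
  exact: (measurable_earlier (prm_filtrationP N_poisson)).
apply: (measurable_integral_prm_left N_poisson) => // x.
by rewrite mule_ge0// ?hawkes_weight_ge0// lee_fin.
Qed.

(** The function g of the overview, possibly +oo. *)
Definition hawkes_total (y : T * plane R) : \bar R :=
  \sum_(n <oo) hawkes_weight n y.

Lemma hawkes_total_ge0 y : 0 <= hawkes_total y.
Proof. by apply: nneseries_ge0 => n _ _; exact: hawkes_weight_ge0. Qed.

Lemma measurable_hawkes_total : measurable_fun setT (hawkes_total : Y -> \bar R).
Proof.
apply: ge0_emeasurable_sum => n *; first exact: hawkes_weight_ge0.
exact: measurable_hawkes_weight.
Qed.

Lemma measurable_mpred_section w (f : Y -> \bar R) : measurable_fun setT f ->
  measurable_fun setT (fun z : plane R => f (w, z)).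
Proof.
move=> mf; apply: (measurableT_comp mf).
apply: measurableT_comp (measurable_id_mpred (prm_filtrationP N_poisson)) _.
exact: pair1_measurable.
Qed.

Lemma hawkes_XE t w : hawkes_X N mu Phi t w =
  \int[N w]_(z in strip `]0%R, t]) hawkes_total (w, z).
Proof.
rewrite /hawkes_total integral_nneseries//.
- rewrite /hawkes_X -(nneseries_addn 1).
    by apply: eq_eseriesr => n _; rewrite addn1 hawkes_termE.
  (* Shifting the series asks for nonnegativity at index 0 too, where the predecessor of 0 being 0
     makes the term equal to that of index 1. *)
  case=> [|i]; first rewrite -[X in _ <= X]/(hawkes_term N mu Phi 1 t w);
    by rewrite hawkes_termE; apply: integral_ge0 => z _; exact: hawkes_weight_ge0.
- exact: measurable_strip.
- move=> n; apply: measurable_funTS.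
  by apply: measurable_mpred_section; exact: measurable_hawkes_weight.
- by move=> n z _; exact: hawkes_weight_ge0.
Qed.

(** A chain ending at z is either z alone or a chain ending at an earlier z', extended by z.
    Positivity of the time is needed because [hawkes_weight 0] vanishes elsewhere. *)
Lemma hawkes_total_rec w (z : plane R) : (0 < z.1)%R ->
  hawkes_total (w, z) = (z.2 <= mu)%R%:R%:E +
    \int[N w]_(z' in strip `]0%R, z.1[)
      ((z.2 <= kernel_pos (z.1 - z'.1))%R%:R%:E * hawkes_total (w, z')).
Proof.
move=> z0; rewrite /hawkes_total nneseries_recl//; last first.
  by move=> n _; exact: hawkes_weight_ge0.
rewrite /= z0; congr (_ + _).
rewrite -(nneseries_addn 1); last by move=> n; exact: hawkes_weight_ge0.
have mc : measurable_fun setT (fun z' : plane R =>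
    ((z.2 <= kernel_pos (z.1 - z'.1))%R%:R : R)%:E).
  apply/measurable_EFinP.
  apply: (measurableT_comp (f := fun b : bool => (b%:R : R))) => //.
  apply: measurable_fun_ler; first exact: measurable_cst.
  by apply: measurableT_comp measurable_kernel_pos _; exact: measurable_funB.
transitivity (\int[N w]_(z' in strip `]0%R, z.1[)
    (\sum_(n <oo) ((z.2 <= kernel_pos (z.1 - z'.1))%R%:R%:E * hawkes_weight n (w, z')))).
  rewrite integral_nneseries.
  - by apply: eq_eseriesr => n _; rewrite addn1.
  - exact: measurable_strip.
  - move=> n; apply: measurable_funTS; apply: emeasurable_funM => //.
    by apply: measurable_mpred_section; exact: measurable_hawkes_weight.
  - by move=> n x _; rewrite mule_ge0// ?hawkes_weight_ge0// lee_fin.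
apply: eq_integral => z' _; rewrite nneseriesZl//.
by move=> n _; exact: hawkes_weight_ge0.
Qed.

Lemma hawkes_X_adapted t : (0 <= t)%R ->
  measurable_wrt (prm_filtration N t) (hawkes_X N mu Phi t).
Proof.
move=> t0.
pose F := g_sigma_algebraType (prm_filtration N t).
pose f (x : F * plane R) : \bar R := hawkes_total
  ((x.1, if (0 < x.2.1 <= t)%R then x.2 else (0%R, 0%R)) : Y).
have -> : hawkes_X N mu Phi t = (fun w : F => \int[N w]_(z in strip `]0%R, t]) f (w, z)).
  apply/funext => w; rewrite hawkes_XE; apply: eq_integral => z; rewrite inE => -[/= + _].
  by rewrite in_itv/= /f /= => ->.
apply: (measurable_integral_prm_before N_poisson) => // [x|].
  exact: hawkes_total_ge0.
apply: (measurableT_comp measurable_hawkes_total).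
exact: (measurable_before (prm_filtrationP N_poisson)).
Qed.

End hawkes_weights.

(** * Independence of the past *)

Section independence.
Context d (T : measurableType d) (R : realType) (P : probability T R).
Variable N : T -> {measure set (plane R) -> \bar R}.
Hypothesis N_poisson : is_poisson_random_measure P N.
Local Open Scope ereal_scope.

Let mN (A : set (plane R)) (B : set (\bar R)) : measurable A -> measurable B ->
  measurable [set w | B (N w A)].
Proof.
move=> mA mB; rewrite -[X in measurable X]setTI.
exact: (prm_measurable N_poisson mA).
Qed.

Section disjoint_family.
Variables (n : nat) (A : 'I_n -> set (plane R)) (D : set (plane R)).
Hypotheses (mA : forall i, measurable (A i)) (mD : measurable D)
  (dA : forall i j, i != j -> A i `&` A j = set0)
  (dAD : forall i, A i `&` D = set0).

Definition family_events : set (set T) :=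
  [set E | exists2 B : 'I_n -> set (\bar R), forall i, measurable (B i) &
    E = \bigcap_(i in [set: 'I_n]) [set w | B i (N w (A i))]].

(** For fixed B both sides are finite measures in E. They agree on the events of the family, which
    are stable under intersection. *)
Lemma family_events_indep E (B : set (\bar R)) : <<s family_events >> E ->
  measurable B ->
  P (E `&` [set w | B (N w D)]) = P E * P [set w | B (N w D)].
Proof.
move=> sE mB; set F := [set w | B (N w D)].
have mF : measurable F by exact: mN.
pose r : {nonneg R} := NngNum (fine_ge0 (measure_ge0 P F)).
have PF : (fine (P F))%:E = P F by rewrite fineK// fin_num_measure.
have mE : measurable E.
  move: sE; apply: smallest_sub; first exact: sigma_algebra_measurable.
  move=> _ [B' mB' ->]; apply: fin_bigcap_measurable => // i _.
  exact: mN.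
suff : forall E, <<s family_events >> E ->
    mrestr P mF E = mscale r P E.
  by move=> /(_ _ sE); rewrite /= /mrestr /mscale /= PF muleC.
apply: (g_sigma_algebra_measure_unique family_events _ (fun=> setT)) => //.
- move=> _ [B' mB' ->]; apply: fin_bigcap_measurable => // i _; exact: mN.
- move=> _; exists (fun=> setT) => //; apply/esym.
  by rewrite -subTset => w _ i _.
- by rewrite bigcup_const.
- move=> _ _ [B1 mB1 ->] [B2 mB2 ->]; exists (fun i => B1 i `&` B2 i).
    by move=> i; exact: measurableI.
  by rewrite bigcapI.
- move=> _ [B' mB' ->]; rewrite /= /mrestr /mscale /= PF /F.
  have h := @prm_indep _ _ _ _ _ N_poisson.
  (* D is inserted at index 0, so that independence applies to n + 1 disjoint sets. *)
  pose A1 (i : 'I_n.+1) := if unlift ord0 i is Some j then A j else D.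
  pose B1 (i : 'I_n.+1) := if unlift ord0 i is Some j then B' j else B.
  have := h n.+1 A1 B1; rewrite big_ord_recl /=.
  have A10 : A1 ord0 = D by rewrite /A1 unlift_none.
  have B10 : B1 ord0 = B by rewrite /B1 unlift_none.
  have A1S j : A1 (lift ord0 j) = A j by rewrite /A1 liftK.
  have B1S j : B1 (lift ord0 j) = B' j by rewrite /B1 liftK.
  rewrite A10 B10.
  under eq_bigr do rewrite A1S B1S.
  rewrite EFinM -(h n A B')// fineK ?fin_num_measure// => <-.
  + congr (P _); apply/seteqP; split => w.
      move=> [wB' wB] i _; rewrite /= /A1 /B1; case: unliftP => //= j _.
      exact: wB'.
    move=> wA; split; last by have := wA ord0 I; rewrite /= A10 B10.
    by move=> i _; have := wA (lift ord0 i) I; rewrite /= A1S B1S.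
  + by move=> i; rewrite /A1; case: unlift.
  + by move=> i; rewrite /B1; case: unlift.
  + move=> i j ij; rewrite /A1; case: unliftP => [i' i'E|i0]; case: unliftP => [j' j'E|j0] //.
    * by apply: dA; apply: contra_neq ij; rewrite i'E j'E => ->.
    * by rewrite setIC.
    * by move: ij; rewrite i0 j0 eqxx.
- by move=> _; rewrite /= /mrestr setTI (le_lt_trans (probability_le1 _ _))// ltry.
Qed.

End disjoint_family.

Section past.
Variables (s : R) (D : set (plane R)).
Hypotheses (s0 : (0 <= s)%R) (mD : measurable D)
  (dD : (`[0%R, s] `*` `[0%R, +oo[) `&` D = set0).

Let S : set (plane R) := `[0%R, s] `*` `[0%R, +oo[.

Let mS : measurable S. Proof. exact: measurableX. Qed.

Definition past_events : set (set T) :=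
  [set E | exists (n : nat) (C : nat -> set (plane R)) (B : nat -> set (\bar R)),
    [/\ forall i, measurable (C i), forall i, C i `<=` S,
        forall i, measurable (B i) &
        E = [set w | forall i, (i < n)%N -> B i (N w (C i))]]].

(** The atoms of the Boolean algebra that C 0, ..., C (n - 1) generate in S, indexed by membership
    patterns. They are disjoint even if the C i overlap, which is what independence requires. *)
Let cell n (C : nat -> set (plane R)) (j : 'I_#|{ffun 'I_n -> bool}|) :=
  S `&` [set z | forall i : 'I_n, (z \in C i) = (enum_val j i)].

Lemma past_events_indep E (B : set (\bar R)) : past_events E ->
  measurable B ->
  P (E `&` [set w | B (N w D)]) = P E * P [set w | B (N w D)].
Proof.
move=> [n [C [B' [mC CS mB' EE]]]] mB.
have mcell j : measurable (@cell n C j).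
  apply: measurableI => //.
  rewrite (_ : mkset _ = \bigcap_(i in [set: 'I_n])
      (if enum_val j i then C i else ~` C i)).
    by apply: fin_bigcap_measurable => // i _; case: ifP => _ //; exact: measurableC.
  apply/seteqP; split => z /= h i; have := h i.
    by case: ifP => _ zC _; [exact: set_mem|move/negbT: zC; rewrite notin_setE].
  case: ifP => _ => [/(_ I)/mem_set//|/(_ I) hn].
  by apply/negbTE; rewrite notin_setE.
have dcell i j : i != j -> @cell n C i `&` @cell n C j = set0.
  move=> ij; apply/seteqP; split => // z [[_ zi] [_ zj]].
  have : enum_val i = enum_val j by apply/ffunP => k; rewrite -zi zj.
  by move=> /enum_val_inj /eqP; rewrite (negbTE ij).
apply: (@family_events_indep _ (@cell n C)) => //.
  move=> i; apply/seteqP; split => // z [[Sz _] Dz].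
  by rewrite -dD; split.
(* On [T] with the sigma-algebra of the cell counts, each N(C i) is measurable as the sum of the
   counts of the cells whose pattern is true at i. *)
pose X := g_sigma_algebraType (family_events (@cell n C)).
have mX j : measurable_fun setT (fun w : X => N w (@cell n C j)).
  move=> _ B1 mB1; rewrite setTI; apply: sub_sigma_algebra.
  exists (fun i => if i == j then B1 else setT).
    by move=> i; case: ifP.
  apply/seteqP; split => w; first by move=> h i _ /=; case: eqP => // ->.
  by move=> /(_ j I) /=; rewrite eqxx.
have mXC i : (i < n)%N -> measurable_fun setT (fun w : X => N w (C i)).
  move=> ni; pose i' := Ordinal ni.
  have CE : C i = \big[setU/set0]_(j < #|{ffun 'I_n -> bool}| | enum_val j i') @cell n C j.
    rewrite -bigcup_seq_cond; apply/seteqP; split => [z Cz|z [j /=]].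
      pose b : {ffun 'I_n -> bool} := [ffun k : 'I_n => z \in C k].
      exists (enum_rank b); first by rewrite /= mem_index_enum enum_rankK ffunE inE.
      by split; [exact: CS Cz|move=> k; rewrite enum_rankK ffunE].
    by move=> /andP[_ ji] [_ /(_ i')]; rewrite ji => /set_mem.
  rewrite CE.
  rewrite (_ : (fun w => _) = (fun w : X => \sum_(j < #|{ffun 'I_n -> bool}|)
      if enum_val j i' then N w (@cell n C j) else 0)).
    by apply: emeasurable_sum => j; case: (enum_val j i').
  apply/funext => w; rewrite measure_bigsetU_ord//; first by rewrite big_mkcond.
  apply/trivIsetP => i1 j1 _ _; exact: dcell.
rewrite EE (_ : mkset _ = \bigcap_(i in `I_n) [set w : X | B' i (N w (C i))]) //.
have : measurable (\bigcap_(i in `I_n) [set w : X | B' i (N w (C i))]).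
  apply: fin_bigcap_measurable => // i /= ni.
  by rewrite -[X in measurable X]setTI; apply: mXC.
by [].
Qed.

(** Finite conjunctions of conditions on past counts are stable under intersection, by concatenating
    the two lists, and their sigma-algebra contains F_s. *)
Lemma past_indep E (B : set (\bar R)) : prm_filtration N s E ->
  measurable B ->
  P (E `&` [set w | B (N w D)]) = P E * P [set w | B (N w D)].
Proof.
move=> FE mB; set F := [set w | B (N w D)].
have mF : measurable F by exact: mN.
pose r : {nonneg R} := NngNum (fine_ge0 (measure_ge0 P F)).
have PF : (fine (P F))%:E = P F by rewrite fineK// fin_num_measure.
suff : forall E, <<s past_events >> E ->
    mrestr P mF E = mscale r P E.
  move=> /(_ E); rewrite /= /mrestr /mscale /= PF muleC; apply.
  move: FE; apply: sub_smallest2r; first exact: smallest_sigma_algebra.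
  move=> _ [I [J [B' [[mI Is] [mJ J0] mB' ->]]]].
  exists 1%N, (fun=> I `*` J), (fun=> B'); split => //.
  - by move=> _; exact: measurableX.
  - by move=> _ [x y] [/Is ? /J0 ?].
  - by apply/seteqP; split => w //= h; exact: (h 0%N).
apply: (g_sigma_algebra_measure_unique past_events _ (fun=> setT)) => //.
- move=> _ [n [C [B' [mC CS mB' ->]]]].
  rewrite (_ : mkset _ = \bigcap_(i in `I_n) [set w | B' i (N w (C i))]) //.
  apply: fin_bigcap_measurable => // i _; exact: mN.
- move=> _; exists 0%N, (fun=> set0), (fun=> setT); split => //.
  by apply/seteqP; split.
- by rewrite bigcup_const.
- move=> _ _ [n1 [C1 [B1 [mC1 CS1 mB1 ->]]]] [n2 [C2 [B2 [mC2 CS2 mB2 ->]]]].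
  exists (n1 + n2)%N, (fun i => if (i < n1)%N then C1 i else C2 (i - n1)%N),
    (fun i => if (i < n1)%N then B1 i else B2 (i - n1)%N); split => //.
  + by move=> i; case: ifP.
  + by move=> i; case: ifP.
  + by move=> i; case: ifP.
  + apply/seteqP; split => w /=.
      move=> [h1 h2] i ilt; case: ifPn => [/h1//|]; rewrite -leqNgt => n1i.
      by apply: h2; rewrite ltn_subLR.
    move=> h; split => i ilt.
      by have := h i; rewrite ilt; apply; rewrite ltn_addr.
    have := h (n1 + i)%N; rewrite ltn_add2l ilt ltnNge leq_addr /= addKn.
    exact.
- move=> E1 E1p; rewrite /= /mrestr /mscale /= PF muleC; exact: past_events_indep.
- by move=> _; rewrite /= /mrestr setTI (le_lt_trans (probability_le1 _ _))// ltry.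
Qed.

End past.


Lemma expR_series (x : R) : (0 <= x)%R ->
  \sum_(k <oo) (x ^+ k / k`!%:R)%:E = (expR x)%:E.
Proof.
move=> x0; rewrite /expR -EFin_lim; last exact: is_cvg_series_exp_coeff.
apply/congr_lim/funext => n; rewrite /= /series /= sumEFin.
by apply: congr1; apply: eq_bigr => i _; rewrite /exp_coeff.
Qed.

(** Cancelling k against k! shifts the index by one and leaves x times the total Poisson mass. *)
Lemma poisson_mean (x : R) : (0 <= x)%R ->
  \sum_(k <oo) (k%:R%:E * (expR (- x) * x ^+ k / k`!%:R)%:E) = x%:E.
Proof.
move=> x0; rewrite nneseries_recl//; last first.
  move=> k _; rewrite -EFinM lee_fin mulr_ge0// divr_ge0// mulr_ge0 ?exprn_ge0//.
rewrite mul0e add0e -(nneseries_addn 1); last first.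
  move=> k; rewrite -EFinM lee_fin mulr_ge0// divr_ge0// mulr_ge0 ?exprn_ge0//.
transitivity (\sum_(k <oo) ((x * expR (- x))%:E * (x ^+ k / k`!%:R)%:E)).
  apply: eq_eseriesr => k _; rewrite addn1 -!EFinM factS exprS natrM invfM.
  congr EFin; have : (k.+1%:R != 0 :> R)%R by rewrite pnatr_eq0.
  move: (k.+1%:R) (k`!%:R)^-1%R (x ^+ k)%R (expR (- x)) => a b c e a0.
  by field.
rewrite nneseriesZl; last by move=> k _; rewrite lee_fin divr_ge0// exprn_ge0.
by rewrite expR_series// -EFinM -mulrA -expRD addNr expR0 mulr1.
Qed.

(** Campbell's formula on a generator. N(D) is natural-valued, hence the sum of k 1{N(D) = k};
    independence of E factors every term and the Poisson law gives the mean. *)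
Lemma past_mean s n (D : set (plane R)) (E : set T) : (0 <= s)%R ->
  measurable D -> D `<=` square n -> (forall z, D z -> (s < z.1)%R) ->
  prm_filtration N s E ->
  \int[P]_(w in E) N w D = P E * intensity D.
Proof.
move=> s0 mD Dn Ds FE.
have mE : measurable E.
  by have [_ h _] := prm_filtrationP N_poisson; exact: h FE.
have Dfin : intensity D < +oo.
  apply: (@le_lt_trans _ _ ((lebesgue_measure \x lebesgue_measure) (@square R n))).
    apply: le_measure; rewrite ?inE; last by move=> z [/Dn].
    - by apply: measurableI => //; exact: measurable_quadrant.
    - exact: measurable_square.
  rewrite /square product_measure1E//=; set l := lebesgue_measure _.
  rewrite /l lebesgue_measure_itv/=.
  by case: ifP => _; rewrite ?mule0// ltry.
have NE w : E w -> N w D = \sum_(k <oo) (k%:R%:E * (\1_[set w | N w D = k%:R%:E] w)%:E).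
  move=> _; have [k Nk] := prm_point N_poisson w mD Dn.
  rewrite (@nneseriesD1 _ _ k)//.
  rewrite indicE mem_set//= mule1 eseries0 ?adde0// => j _ jk.
  rewrite indicE memNset ?mule0// => /= Nj.
  by move: jk; rewrite Nk in Nj; move: Nj => [] /eqP; rewrite eqr_nat eq_sym => ->.
have mNk k : measurable [set w | N w D = k%:R%:E].
  by apply: (mN (B := [set k%:R%:E])) => //; exact: emeasurable_set1.
transitivity (\sum_(k <oo) (k%:R%:E * (P E * P [set w | N w D = k%:R%:E]))).
  under eq_integral => w /set_mem Ew do rewrite NE//.
  rewrite integral_nneseries//; last first.
    move=> k; apply: measurable_funTS; apply: measurable_funeM.
    by apply/measurable_EFinP; exact: measurable_indic.
  apply: eq_eseriesr => k _.
  rewrite ge0_integralZl//; last first.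
    by apply: measurable_funTS; apply/measurable_EFinP; exact: measurable_indic.
  rewrite integral_indic//; congr (_ * _); rewrite setIC.
  apply: (past_indep mD _ (B := [set k%:R%:E]) FE) => //.
  apply/seteqP; split => // z [] /= [+ _] Dz; rewrite in_itv/= => /andP[_ zs].
  by have := lt_le_trans (Ds _ Dz) zs; rewrite ltxx.
have i0 : 0 <= intensity D by exact: measure_ge0.
transitivity (\sum_(k <oo) ((fine (P E))%:E *
  (k%:R%:E * (expR (- fine (intensity D)) * fine (intensity D) ^+ k / k`!%:R)%:E))).
  apply: eq_eseriesr => k _; rewrite (prm_law N_poisson)// fineK ?fin_num_measure//.
  by rewrite muleCA.
rewrite nneseriesZl; last first.
  move=> k _; rewrite -EFinM lee_fin mulr_ge0// divr_ge0// mulr_ge0 ?exprn_ge0 ?fine_ge0//.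
rewrite poisson_mean ?fine_ge0// !fineK ?fin_num_measure//.
by rewrite ge0_fin_numE.
Qed.

End independence.

(** * Campbell's formula *)

Section image_measure.
Local Open Scope ereal_scope.
Context d d' (X : measurableType d) (Z : measurableType d') (R : realType).
Variables (m : {measure set X -> \bar R}) (f : X -> Z).
Hypothesis mf : measurable_fun setT f.

Definition image_measure : {measure set Z -> \bar R}.
Proof. unshelve refine (pushforward m f : {measure set Z -> \bar R}); exact: mf. Defined.

Lemma ge0_integral_image_measure D (h : Z -> \bar R) :
  measurable D -> measurable_fun D h -> {in D, forall y, 0 <= h y} ->
  \int[image_measure]_(y in D) h y = \int[m]_(x in f @^-1` D) h (f x).
Proof. exact: ge0_integral_pushforward. Qed.

End image_measure.

Section campbell_measure.
Local Open Scope ereal_scope.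
Context d d' (T : measurableType d) (Z : measurableType d') (R : realType)
  (P : probability T R).

(** Seen as a kernel from a point, P can be composed with kernels from [T]. *)
Lemma probability_kernel : exists K : R.-sfker unit ~> T,
  forall U, measurable U -> P U = K tt U.
Proof.
pose E i : set T := if i is 0%N then setT else set0.
have [|||||K hK] := @sfinite_kernel_of_cover _ _ unit T R (fun=> P) E.
- by case=> [|i]; [exact: measurableT|exact: measurable0].
- apply/trivIsetP => -[|i] [|j] _ _ //=; rewrite ?setI0 ?set0I//.
- by apply/seteqP; split => // w _; exists 0%N.
- move=> _ i; apply: (le_lt_trans _ (ltry 1)); apply: probability_le1.
  by case: i => [|i]; [exact: measurableT|exact: measurable0].
- by move=> U mU; exact: measurable_cst.
by exists K => U mU; rewrite -hK.
Qed.

Section composition.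
Variables (k : T -> {measure set Z -> \bar R}) (E : nat -> set Z).
Hypotheses (mE : forall i, measurable (E i)) (tE : trivIset setT E)
  (covE : \bigcup_i E i = setT) (kE : forall y i, k y (E i) < +oo)
  (mk : forall U, measurable U -> measurable_fun setT (k ^~ U)).

(** Composition forgets the intermediate point, so k w is carried to the fibre over w to retain
    it. *)
Let graph (x : unit * T) : {measure set (T * Z) -> \bar R} :=
  image_measure (k x.2) (pair1_measurable x.2).

(** M is the measure P(dw) k(w, dz). *)
Lemma composition_measure : exists M : {measure set (T * Z) -> \bar R},
  forall f, (forall x, 0 <= f x) -> measurable_fun setT f ->
  \int[M]_x f x = \int[P]_w \int[k w]_z f (w, z).
Proof.
have [K1 hK1] := probability_kernel.
have [|||||K2 hK2] := @sfinite_kernel_of_cover _ _ (unit * T)%type (T * Z)%type R graph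
    (fun i => setT `*` E i).
- by move=> i; exact: measurableX.
- apply/trivIsetP => i j _ _ ij; rewrite -setXI setIid.
  by move/trivIsetP : tE => ->//; rewrite setX0.
- by rewrite -setX_bigcupr covE setXTT.
- move=> [u w] i; rewrite /graph /= /pushforward.
  rewrite (_ : _ @^-1` _ = E i)//.
  by apply/seteqP; split => z //= [].
- move=> U mU; rewrite (_ : (fun x => _) = (fun w => \int[k w]_z (\1_U (w, z))%:E) \o snd).
    apply: measurableT_comp => //.
    apply: (measurable_integral_cover mE tE covE kE mk
      (f := fun x => (\1_U x)%:E)) => //.
    by apply/measurable_EFinP; exact: measurable_indic.
  apply/funext => -[u w] /=.
  rewrite (_ : (fun z => _) = (fun z => (\1_(pair w @^-1` U) z)%:E)).
    rewrite integral_indic ?setIT//.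
    by rewrite -[X in measurable X]setTI; exact: (pair1_measurable w).
  by apply/funext => z; rewrite !indicE.
exists ((K1 \; K2) tt) => f f0 mf.
rewrite integral_kcomp//.
rewrite [LHS](eq_measure_integral P); last by move=> A mA _; rewrite -hK1.
apply: eq_integral => w _.
rewrite [LHS](eq_measure_integral (graph (tt, w))); last by move=> A mA _; rewrite -hK2.
by rewrite /graph ge0_integral_image_measure.
Qed.

End composition.
End campbell_measure.

Lemma sigma_finite_cover d (Z : measurableType d) (R : realType)
    (m : {measure set Z -> \bar R}) : sigma_finite setT m -> exists E : nat -> set Z,
  [/\ forall i, measurable (E i), trivIset setT E, \bigcup_i E i = setT &
      forall i, (m (E i) < +oo)%E].
Proof.
move=> [F FT mF].
have mE i : measurable (seqDU F i).
  apply: measurableD; first exact: (mF i).1.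
  by apply: bigsetU_measurable => j _; exact: (mF j).1.
exists (seqDU F); split => //; first by rewrite -seqDU_bigcup_eq -FT.
move=> i; apply: le_lt_trans (mF i).2; apply: le_measure; rewrite ?inE//.
- exact: (mF i).1.
- exact: subDsetl.
Qed.

Section campbell.
Context d (T : measurableType d) (R : realType) (P : probability T R).
Variable N : T -> {measure set (plane R) -> \bar R}.
Hypothesis N_poisson : is_poisson_random_measure P N.
Local Open Scope ereal_scope.

Local Notation lambda2 := ((@lebesgue_measure R) \x (@lebesgue_measure R)).
Local Notation Y := (mpred (prm_filtration N)).
Local Notation future := (@strip R `]0%R, +oo[).

Let mfuture : measurable future. Proof. exact: measurable_strip. Qed.

Let restr (m : {measure set (plane R) -> \bar R}) : {measure set (plane R) -> \bar R} :=
  mrestr m mfuture.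

Let le_restr (m : {measure set (plane R) -> \bar R}) A :
  measurable A -> restr m A <= m A.
Proof.
by move=> mA; apply: le_measure; rewrite ?inE//; exact: measurableI.
Qed.

Lemma lambda2_square_lty n : lambda2 (square n) < +oo.
Proof.
rewrite /square product_measure1E//=; set l := lebesgue_measure _.
rewrite /l lebesgue_measure_itv/=.
by case: ifP => _; rewrite ?mule0// ltry.
Qed.

Lemma lambda2_sigma_finite : sigma_finite setT lambda2.
Proof.
exists (fun n : nat => `[(- n%:R)%R, n%:R] `*` `[(- n%:R)%R, n%:R]).
  apply/seteqP; split => // -[x y] _.
  exists (Num.truncn (Num.max `|x| `|y|)%R).+1 => //=.
  have := truncnS_gt (Num.max `|x| `|y|)%R; rewrite gt_max => /andP[/ltW hx /ltW hy].
  by rewrite !in_itv/= -!ler_norml.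
move=> n; split; first by apply: measurableX; exact: measurable_itv.
rewrite product_measure1E//=; set l := lebesgue_measure _.
rewrite /l lebesgue_measure_itv/=.
by case: ifP => _; rewrite ?mule0// ltry.
Qed.

(** P(dw) N(w, dz) and P(dw) dz, both restricted to positive times and nonnegative marks, agree on
    the generators of [mpred] by [past_mean]. Uniqueness of measures extends this to predictable
    sets and thus to predictable integrands. *)
Lemma campbell (H : T * plane R -> \bar R) :
  (forall x, 0 <= H x) -> measurable_fun setT (H : Y -> \bar R) ->
  \int[P]_w \int[N w]_(z in future) H (w, z) =
  \int[P]_w \int[lambda2]_(z in future) H (w, z).
Proof.
move=> H0 mH; have FP := prm_filtrationP N_poisson; have [sF Fm FS] := FP.
have mH' : measurable_fun setT (H : T * plane R -> \bar R).
  exact: measurableT_comp mH (measurable_id_mpred FP).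
have [E [mE tE cE NE]] := prm_cover N_poisson.
have mrN U : measurable U -> measurable_fun setT (fun w => restr (N w) U).
  by move=> mU; apply: (prm_measurable N_poisson); exact: measurableI.
have [|M1 hM1] := composition_measure P mE tE cE (k := fun w => restr (N w)) _ mrN.
  by move=> w i; apply: le_lt_trans (NE w i); exact: le_restr.
have [E' [mE' tE' cE' lE']] := sigma_finite_cover lambda2_sigma_finite.
have [||M2 hM2] := composition_measure P mE' tE' cE' (k := fun=> restr lambda2).
- by move=> _ i; apply: le_lt_trans (lE' i); exact: le_restr.
- by move=> U mU; exact: measurable_cst.
have int1 w : \int[N w]_(z in future) H (w, z) = \int[restr (N w)]_z H (w, z).
  rewrite integral_mrestr//; exact: measurableT_comp mH' (pair1_measurable w).
have int2 w : \int[lambda2]_(z in future) H (w, z) = \int[restr lambda2]_z H (w, z).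
  rewrite integral_mrestr//; exact: measurableT_comp mH' (pair1_measurable w).
under eq_integral do rewrite int1.
under [in RHS]eq_integral do rewrite int2.
rewrite -hM1// -hM2//.
(* Pushing forward by this identity restricts both measures to the predictable sigma-algebra. *)
pose idY : T * plane R -> Y := id.
have midY : measurable_fun setT idY by exact: measurable_id_mpred.
transitivity (\int[image_measure M1 midY]_y H y).
  by rewrite ge0_integral_image_measure.
transitivity (\int[image_measure M2 midY]_y H y); last first.
  by rewrite ge0_integral_image_measure.
have ME (M : {measure set (T * plane R) -> \bar R})
    (k : T -> {measure set (plane R) -> \bar R}) A D :
    (forall f, (forall x, 0 <= f x) -> measurable_fun setT f ->
      \int[M]_x f x = \int[P]_w \int[restr (k w)]_z f (w, z)) ->
    measurable A -> measurable D ->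
    M (A `*` D) = \int[P]_(w in A) k w (D `&` future).
  move=> hM mA mD.
  have -> : M (A `*` D) = \int[M]_x (\1_(A `*` D) x)%:E.
    by rewrite integral_indic ?setIT//; exact: measurableX.
  rewrite hM//; last first.
    by apply/measurable_EFinP; apply: measurable_indic; exact: measurableX.
  rewrite [RHS]integral_mkcond; apply: eq_integral => w _.
  rewrite patchE; case: ifPn => wA.
    rewrite (_ : (fun z => _) = (fun z => (\1_D z)%:E)).
      by rewrite integral_indic ?setIT.
    apply/funext => z; rewrite !indicE; congr ((_ : bool)%:R%:E).
    by apply/idP/idP; rewrite !inE => //=; [move=> []|split => //; exact: set_mem].
  apply: integral0_eq => z _; rewrite indicE memNset//= => -[/mem_set].
  by rewrite (negbTE wA).
(* A cover by generators of finite mass: the nonpositive times, which are null, and growing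
   boxes. *)
pose g n : set Y := if n is n'.+1 then setT `*` (`]0%R, n'%:R] `*` `[(- n'%:R)%R, n'%:R])
  else setT `*` (`]-oo, 0%R] `*` setT).
have F0 : prm_filtration N 0%R setT.
  by apply/(measurable_sigma_algebraE (sF 0%R (lexx _))); exact: measurableT.
have nonpos : (`]-oo, 0%R] `*` setT) `&` future = set0.
  apply/seteqP; split => // -[x y] /= [[+ _]] [/= + _]; rewrite !in_itv/= andbT.
  by move=> /le_lt_trans h /h; rewrite ltxx.
have mnonpos : measurable (`]-oo, 0%R] `*` setT : set (plane R)) by exact: measurableX.
have intc A (c : \bar R) : measurable A -> \int[P]_(_ in A) c = c * P A.
  by move=> mA; exact: integral_cst.
have gE n : M2 (g n) < +oo.
  case: n => [|n] /=; rewrite (ME M2 (fun=> lambda2))//.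
    by rewrite nonpos measure0 integral0.
  2: by apply: measurableX; exact: measurable_itv.
  rewrite intc// (_ : P setT = 1) ?mule1; last exact: probability_setT.
  apply: le_lt_trans (lambda2_square_lty n).
  apply: le_measure; rewrite ?inE.
  - by apply: measurableI => //; exact: measurableX.
  - exact: measurable_square.
  move=> [x y] [/= [+ +] [/= _ +]]; rewrite /square /= !in_itv/= andbT.
  by move=> /andP[/ltW -> ->] /andP[_ ->] ->.
have agree A : mpred_gen (prm_filtration N) A -> M1 A = M2 A.
  move=> [->|[s [t [B [n [J [s0 FB mJ Jn ->]]]]]]].
    rewrite (ME M1 N)// (ME M2 (fun=> lambda2))//.
    by rewrite nonpos measure0; apply: eq_integral => w _; rewrite measure0.
  have mB : measurable B by exact: Fm FB.
  have qE : ((`]s, t] `*` J) `&` future) `&` @quadrant R = (`]s, t] `*` J) `&` future.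
    apply/seteqP; split => [z []//|[x y] [xyD [/= x0 y0]]]; split => //; split => //=.
    by move: x0; rewrite !in_itv/= !andbT; exact: ltW.
  have mD : measurable (`]s, t] `*` J : set (plane R)) by exact: measurableX.
  rewrite (ME M1 N)// (ME M2 (fun=> lambda2))//.
  rewrite (@past_mean _ _ _ _ _ N_poisson s (maxn n (Num.truncn t).+1))//.
  - by rewrite intc// muleC /intensity qE.
  - exact: measurableI.
  - move=> [x y] [/= [+ Jy] [/= _ +]]; have := Jn _ Jy.
    rewrite /square /= !in_itv/= andbT => /andP[_ yn] /andP[sx xt] ->.
    rewrite (le_trans s0 (ltW sx)) (le_trans yn) ?ler_nat ?leq_maxl//=; split => //.
    by rewrite (le_trans xt)// (le_trans (ltW (truncnS_gt _)))// ler_nat leq_maxr.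
  - by move=> [x y] [/= [+ _] _]; rewrite in_itv/= => /andP[].
have gG n : mpred_gen (prm_filtration N) (g n).
  case: n => [|n]; first by left.
  right; exists 0%R, n%:R, setT, n, `[(- n%:R)%R, n%:R]%classic; split => //.
apply: eq_measure_integral => A mA _.
apply: (@measure_unique _ _ Y (mpred_gen (prm_filtration N)) g) => //.
- exact: mpred_gen_setI.
- apply/seteqP; split => // -[w [v th]] _.
  have [v0|v0] := leP v 0%R; first by exists 0%N => //=; rewrite in_itv/=.
  (* One above an integer bound of v and |th|, since [g n.+1] is the box of size n. *)
  exists (Num.truncn (Num.max v `|th|)%R).+2 => //=.
  have := truncnS_gt (Num.max v `|th|)%R; rewrite gt_max => /andP[/ltW hx /ltW hy].
  by rewrite !in_itv/= -!ler_norml v0.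
- by move=> n; rewrite /= /pushforward preimage_id agree.
Qed.

End campbell.

(** * First moments *)

Section integral_generalities.
Local Open Scope ereal_scope.
Context d d' (X : measurableType d) (Z : measurableType d') (R : realType).
Implicit Type m : {measure set X -> \bar R}.

(** The integral of a nonnegative function is a supremum over simple functions below it, so it is
    monotone even for nonmeasurable functions. *)
Lemma ge0_le_integral_nomeas m (D : set X) (f g : X -> \bar R) :
  (forall x, D x -> 0 <= f x) -> (forall x, D x -> f x <= g x) ->
  \int[m]_(x in D) f x <= \int[m]_(x in D) g x.
Proof.
move=> f0 fg; rewrite !ge0_integralE//; last first.
  by move=> x Dx; exact: le_trans (f0 _ Dx) (fg _ Dx).
apply: le_ereal_sup => _ [h hf <-]; exists h => //= x.
apply: (le_trans (hf x)); rewrite !patchE; case: ifPn => // /set_mem; exact: fg.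
Qed.

Lemma measurable_integral_param m (S : set X) (f : Z * X -> \bar R) :
  sigma_finite setT m -> measurable S -> (forall x, 0 <= f x) ->
  measurable_fun setT f ->
  measurable_fun setT (fun z => \int[m]_(x in S) f (z, x)).
Proof.
move=> sm mS f0 mf; have [E [mE tE cE mEoo]] := sigma_finite_cover sm.
pose k (_ : Z) : {measure set X -> \bar R} := mrestr m mS.
rewrite (_ : (fun z => _) = (fun z => \int[k z]_x f (z, x))); last first.
  by apply/funext => z; rewrite integral_mrestr//; exact: measurableT_comp mf (pair1_measurable z).
apply: (measurable_integral_cover mE tE cE) => //.
move=> z i; apply: le_lt_trans (mEoo i).
by apply: le_measure; rewrite ?inE//; exact: measurableI.
Qed.

End integral_generalities.

Section fubini_sets.
Local Open Scope ereal_scope.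
Context d d' (X : measurableType d) (Z : measurableType d') (R : realType).
Variables (m1 : {measure set X -> \bar R}) (m2 : {measure set Z -> \bar R}).
Hypotheses (s1 : sigma_finite setT m1) (s2 : sigma_finite setT m2).
Variables (A : set X) (B : set Z).
Hypotheses (mA : measurable A) (mB : measurable B).

(** Sigma-finiteness is a hypothesis here because for N w it is only known through [prm_cover]. *)
Lemma tonelli_setX (f : X * Z -> \bar R) :
  (forall x, 0 <= f x) -> measurable_fun setT f ->
  \int[m1]_(x in A) \int[m2]_(y in B) f (x, y) =
  \int[m2]_(y in B) \int[m1]_(x in A) f (x, y).
Proof.
move=> f0 mf.
pose f1 := isSFinite.Build _ _ _ (Measure.sort m1) (sfinite_measure_sigma_finite s1).
pose g1 := isSigmaFinite.Build _ _ _ (Measure.sort m1) s1.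
pose n1 := HB.pack_for (SigmaFiniteMeasure.type X R) (Measure.sort m1) f1 g1.
pose f2 := isSFinite.Build _ _ _ (Measure.sort m2) (sfinite_measure_sigma_finite s2).
pose g2 := isSigmaFinite.Build _ _ _ (Measure.sort m2) s2.
pose n2 := HB.pack_for (SigmaFiniteMeasure.type Z R) (Measure.sort m2) f2 g2.
have mfAB : measurable_fun setT (f \_ (A `*` B)).
  by apply/(measurable_restrictT _ _).1; [exact: measurableX|exact: measurable_funTS].
have := @fubini_tonelli _ _ _ _ _ n1 n2 (f \_ (A `*` B)) mfAB.
rewrite -[Measure.sort n1]/(Measure.sort m1) -[Measure.sort n2]/(Measure.sort m2).
move=> H; rewrite integral_mkcond [RHS]integral_mkcond.
transitivity (\int[m1]_x \int[m2]_y (f \_ (A `*` B)) (x, y)).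
  apply: eq_integral => x _; rewrite patchE; case: ifPn => xA.
    rewrite integral_mkcond; apply: eq_integral => y _; rewrite !patchE.
    congr (if _ then _ else _); apply/idP/idP; rewrite !inE => //=.
      by split => //; exact: set_mem.
    by case.
  apply/esym/integral0_eq => y _; rewrite patchE memNset// => -[/= /mem_set].
  by rewrite (negbTE xA).
rewrite H; last by move=> x; rewrite patchE; case: ifP.
apply: eq_integral => y _; rewrite patchE; case: ifPn => yB.
  rewrite [RHS]integral_mkcond; apply: eq_integral => x _; rewrite !patchE.
  congr (if _ then _ else _); apply/idP/idP; rewrite !inE => //=.
    by case.
  by split => //; exact: set_mem.
apply: integral0_eq => x _; rewrite patchE memNset// => -[/= _ /mem_set].
by rewrite (negbTE yB).
Qed.

End fubini_sets.

Section lebesgue_facts.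
Local Open Scope ereal_scope.
Context (R : realType).
Local Notation leb := (@lebesgue_measure R).

Lemma lebesgue_sigma_finite : sigma_finite setT leb.
Proof. exact: sigma_finiteT. Qed.

Lemma integral_product_setX (A B : set (measurableTypeR R))
    (f : plane R -> \bar R) : measurable A -> measurable B ->
  (forall x, 0 <= f x) -> measurable_fun setT f ->
  \int[leb \x leb]_(z in A `*` B) f z =
  \int[leb]_(x in A) \int[leb]_(y in B) f (x, y).
Proof.
move=> mA mB f0 mf.
have mfAB : measurable_fun setT (f \_ (A `*` B)).
  by apply/(measurable_restrictT _ _).1; [exact: measurableX|exact: measurable_funTS].
rewrite integral_mkcond fubini_tonelli1//; last first.
  by move=> x; rewrite patchE; case: ifP.
rewrite [RHS]integral_mkcond.
apply: eq_integral => x _; rewrite [RHS]patchE; case: ifPn => xA.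
  rewrite [RHS]integral_mkcond; apply: eq_integral => y _; rewrite !patchE.
  congr (if _ then _ else _); apply/idP/idP; rewrite !inE => //=.
    by case.
  by split => //; exact: set_mem.
apply: integral0_eq => y _; rewrite patchE memNset// => -[/= /mem_set].
by rewrite (negbTE xA).
Qed.

(** Integrating out the mark turns an acceptance indicator into a rate. *)
Lemma integral_mark (c : R) : (0 <= c)%R ->
  \int[leb]_(x in `[0%R, +oo[) (x <= c)%R%:R%:E = c%:E.
Proof.
move=> c0; transitivity (\int[leb]_(x in `[0%R, +oo[) (\1_(`[0%R, c]) x)%:E).
  apply: eq_integral => x; rewrite inE /= in_itv/= andbT => x0.
  by rewrite indicE mem_setE in_itv/= x0.
rewrite integral_indic//= (_ : _ `&` _ = `[0%R, c]%classic).
  rewrite lebesgue_measure_itv/= lte_fin; case: ifPn => [_|]; first by rewrite sube0.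
  by rewrite -leNgt => cle0; congr EFin; apply/eqP; rewrite eq_le c0.
apply/seteqP; split => x /=; rewrite !in_itv/= ?andbT; first by case.
by move=> /andP[-> ->].
Qed.

(** The translate of Lebesgue measure has the same mass on half-open intervals, hence equals it. *)
Lemma integral_translation (f : R -> \bar R) (a : R) :
  (forall x, 0 <= f x) -> measurable_fun setT f ->
  \int[leb]_x f (x - a)%R = \int[leb]_x f x.
Proof.
move=> f0 mf.
have ms : measurable_fun setT ((fun x => x - a)%R : measurableTypeR R -> measurableTypeR R).
  exact: measurable_funB.
transitivity (\int[image_measure leb ms]_x f x).
  by rewrite ge0_integral_image_measure.
apply/esym; apply: eq_measure_integral => A mA _.
apply: lebesgue_measure_unique => // _ [[x y] _ <-].
rewrite /= /pushforward (_ : _ @^-1` _ = `]x + a, y + a]%classic)%R.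
  by rewrite !lebesgue_measure_itv/= !lte_fin ltrD2r -!EFinB opprD addrACA subrr addr0.
by apply/seteqP; split => r /=; rewrite !in_itv/= ltrBrDr lerBlDr.
Qed.

End lebesgue_facts.

(** * Mean numbers of chains *)

Section moments.
Context d (T : measurableType d) (R : realType) (P : probability T R).
Variable N : T -> {measure set (plane R) -> \bar R}.
Hypothesis N_poisson : is_poisson_random_measure P N.
Variables (mu : R) (Phi : R -> R).
Hypothesis mu_gt0 : 0 < mu.
Hypothesis Phi_ge0 : forall x, 0 <= x -> 0 <= Phi x.
Hypothesis Phi_meas : measurable_fun (`[0, +oo[%classic : set (measurableTypeR R)) Phi.
Local Open Scope ereal_scope.

Local Notation leb := (@lebesgue_measure R).
Local Notation lambda2 := (leb \x leb).
Local Notation F := (prm_filtration N).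
Local Notation Y := (mpred F).
Local Notation phi := (kernel_pos Phi).
Local Notation weight := (hawkes_weight N mu Phi).
Local Notation total := (hawkes_total N mu Phi).
Let FP := prm_filtrationP N_poisson.

Lemma kernel_pos_ge0 x : (0 <= phi x)%R.
Proof.
rewrite /kernel_pos patchE; case: ifPn => // /set_mem /=.
by rewrite in_itv/= andbT; exact: Phi_ge0.
Qed.

Lemma prm_sigma_finite w : sigma_finite setT (N w).
Proof.
have [E [mE _ cE NE]] := prm_cover N_poisson.
by exists E.
Qed.

(** As A belongs to F_s, the set A x ]s, t] x R is predictable, and [campbell] applies to H cut off
    outside it. *)
Lemma campbell_between s t A (H : T * plane R -> \bar R) :
  (0 <= s)%R -> (s <= t)%R -> F s A ->
  (forall x, 0 <= H x) -> measurable_fun setT (H : Y -> \bar R) ->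
  \int[P]_(w in A) \int[N w]_(z in strip `]s, t]) H (w, z) =
  \int[P]_(w in A) \int[lambda2]_(z in strip `]s, t]) H (w, z).
Proof.
move=> s0 st FA H0 mH; have [sF Fm FS] := FP.
pose U : set Y := A `*` (`]s, t] `*` setT).
have mU : measurable U by exact: mpred_measurable_after.
have := @campbell _ _ _ _ _ N_poisson (H \_ U).
have mHU : measurable_fun setT (H \_ U : Y -> \bar R).
  have := (measurable_restrictT (H : Y -> \bar R) mU).1; apply.
  by apply: measurable_funTS; exact: mH.
move=> /(_ _ mHU) h.
have restr (m : {measure set (plane R) -> \bar R}) w :
    \int[m]_(z in strip `]0%R, +oo[) (H \_ U) (w, z) =
    if w \in A then \int[m]_(z in strip `]s, t]) H (w, z) else 0.
  rewrite integral_mkcond; case: ifPn => wA.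
    rewrite [RHS]integral_mkcond; apply: eq_integral => -[v th] _.
    rewrite !patchE; case: ifPn => [/set_mem[/= v0 th0]|].
      congr (if _ then _ else _); apply/idP/idP; rewrite !inE.
        by move=> [_ [vst _]].
      by move=> [vst _]; split => //=; exact: set_mem.
    move=> hn; rewrite memNset// => -[/= vst th0]; move: hn.
    rewrite mem_set//; split => //=; move: vst; rewrite !in_itv/= andbT => /andP[sv _].
    exact: le_lt_trans sv.
  apply: integral0_eq => z _; rewrite !patchE; case: ifP => // _.
  by rewrite memNset// => -[/= /mem_set]; rewrite (negbTE wA).
rewrite integral_mkcond [RHS]integral_mkcond.
transitivity (\int[P]_w \int[N w]_(z in strip `]0%R, +oo[) (H \_ U) (w, z)).
  by apply: eq_integral => w _; rewrite restr patchE.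
rewrite h; last by move=> x; rewrite patchE; case: ifP.
by apply: eq_integral => w _; rewrite (restr lambda2) patchE.
Qed.

Lemma integral_mark_prm w v (h : plane R -> \bar R) :
  (forall z, 0 <= h z) -> measurable_fun setT h ->
  \int[leb]_(th in `[0%R, +oo[) \int[N w]_(z in strip `]0%R, v[)
    ((th <= phi (v - z.1))%R%:R%:E * h z) =
  \int[N w]_(z in strip `]0%R, v[) ((phi (v - z.1))%:E * h z).
Proof.
move=> h0 mh.
pose f (x : plane R * measurableTypeR R) : \bar R :=
  (x.2 <= phi (v - x.1.1))%R%:R%:E * h x.1.
have mphi : measurable_fun setT (fun z : plane R => phi (v - z.1)).
  apply: measurableT_comp (measurable_kernel_pos Phi_meas) _.
  exact: measurable_funB.
have mf : measurable_fun setT f.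
  apply: emeasurable_funM; last exact: measurableT_comp mh measurable_fst.
  apply/measurable_EFinP.
  apply: (measurableT_comp (f := fun b : bool => (b%:R : R))) => //.
  apply: measurable_fun_ler => //; exact: measurableT_comp mphi measurable_fst.
have f0 x : 0 <= f x by rewrite mule_ge0// lee_fin.
rewrite -[LHS](tonelli_setX (prm_sigma_finite w) (lebesgue_sigma_finite R) _ _ f0 mf)//; last first.
  exact: measurable_strip.
apply: eq_integral => z _; rewrite /f /=.
under eq_integral do rewrite muleC.
rewrite ge0_integralZl//.
- by rewrite integral_mark ?kernel_pos_ge0// muleC.
- apply: measurable_funTS; apply/measurable_EFinP.
  apply: (measurableT_comp (f := fun b : bool => (b%:R : R))) => //.
  apply: measurable_fun_ler => //; exact: measurable_cst.
Qed.

Lemma measurable_section w (f : Y -> \bar R) : measurable_fun setT f ->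
  measurable_fun setT (fun z : plane R => f (w, z)).
Proof. exact: (measurable_mpred_section N_poisson). Qed.

Lemma integral_mark_total w v : (0 < v)%R ->
  \int[leb]_(th in `[0%R, +oo[) total (w, (v, th)) =
  mu%:E + \int[N w]_(z in strip `]0%R, v[) ((phi (v - z.1))%:E * total (w, z)).
Proof.
move=> v0; under eq_integral do rewrite (hawkes_total_rec N_poisson)//.
rewrite ge0_integralD//=.
- rewrite integral_mark ?ltW// integral_mark_prm//.
  + by move=> z; exact: hawkes_total_ge0.
  + by apply: measurable_section; exact: (measurable_hawkes_total N_poisson mu Phi_meas).
- apply: measurable_funTS; apply/measurable_EFinP.
  apply: (measurableT_comp (f := fun b : bool => (b%:R : R))) => //.
  apply: measurable_fun_ler => //; exact: measurable_cst.
- by move=> th _; apply: integral_ge0 => z _; rewrite mule_ge0// ?hawkes_total_ge0// lee_fin.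
- apply: measurable_funTS.
  pose f (x : measurableTypeR R * plane R) : \bar R :=
    (x.1 <= phi (v - x.2.1))%R%:R%:E * total (w, x.2).
  apply: (measurable_integral_param (f := f) (prm_sigma_finite w)) => //.
  + exact: measurable_strip.
  + by move=> x; rewrite mule_ge0// ?hawkes_total_ge0// lee_fin.
  + apply: emeasurable_funM.
      apply/measurable_EFinP.
      apply: (measurableT_comp (f := fun b : bool => (b%:R : R))) => //.
      apply: measurable_fun_ler => //.
      apply: measurableT_comp (measurable_kernel_pos Phi_meas) _.
      by apply: measurable_funB => //; exact: measurableT_comp measurable_fst measurable_snd.
    apply: (measurableT_comp (f := fun z : plane R => total (w, z))) => //.
    by apply: measurable_section; exact: (measurable_hawkes_total N_poisson mu Phi_meas).
Qed.

Lemma measurable_mpred_prod (f : Y -> \bar R) : measurable_fun setT f ->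
  measurable_fun setT (f : T * plane R -> \bar R).
Proof. by move=> mf; exact: measurableT_comp mf (measurable_id_mpred FP). Qed.

(** The norm of Phi in L^1, that is the mean number of direct offspring of an atom. *)
Definition branching_ratio : \bar R := \int[leb]_x (phi x)%:E.

(** Campbell's formula and integration of the last mark replace the last acceptance by the rate
    phi(v - v'). Integrating v over all of R bounds the offspring of each earlier atom by the
    branching ratio. *)
Lemma moment_le n t : (0 <= t)%R ->
  \int[P]_w \int[N w]_(z in strip `]0%R, t]) weight n.+1 (w, z) <=
  branching_ratio * \int[P]_w \int[N w]_(z in strip `]0%R, t]) weight n (w, z).
Proof.
move=> t0; have [sF Fm FS] := FP.
have FT : F 0%R setT.
  by apply/(measurable_sigma_algebraE (sF 0%R (lexx _))); exact: measurableT.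
have mw k := measurable_hawkes_weight N_poisson mu Phi_meas k.
rewrite (campbell_between (lexx _) t0 FT)//; last by move=> x; exact: hawkes_weight_ge0.
have mwz k w : measurable_fun setT (fun z : plane R => weight k (w, z)).
  exact: measurable_section (mw k).
have mphi : measurable_fun setT (fun x : plane R * measurableTypeR R => phi (x.2 - x.1.1)).
  apply: measurableT_comp (measurable_kernel_pos Phi_meas) _.
  by apply: measurable_funB => //; exact: measurableT_comp measurable_fst measurable_fst.
rewrite -ge0_integralZl//; last 3 first.
- apply: (measurable_integral_prmT N_poisson (f := weight n)) => //.
  + exact: measurable_strip.
  + by move=> x; exact: hawkes_weight_ge0.
  + exact: measurable_mpred_prod (mw n).
- by move=> w _; apply: integral_ge0 => z _; exact: hawkes_weight_ge0.
- by apply: integral_ge0 => x _; rewrite lee_fin kernel_pos_ge0.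
apply: ge0_le_integral_nomeas.
  by move=> w _; apply: integral_ge0 => z _; exact: hawkes_weight_ge0.
move=> w _.
rewrite /strip integral_product_setX//; last by move=> x; exact: hawkes_weight_ge0.
pose f (x : plane R * measurableTypeR R) : \bar R :=
  (phi (x.2 - x.1.1))%:E * weight n (w, x.1).
have f0 x : 0 <= f x by rewrite mule_ge0// ?hawkes_weight_ge0// lee_fin kernel_pos_ge0.
have mf : measurable_fun setT f.
  apply: emeasurable_funM; first exact/measurable_EFinP.
  exact: measurableT_comp (mwz n w) measurable_fst.
(* Enlarging ]0, v[ to ]0, t] makes the domain a product for Tonelli, and letting v range over R
   makes its integral translation invariant. *)
apply: (@le_trans _ _ (\int[leb]_(v in setT) \int[N w]_(z in strip `]0%R, t]) f (z, v))).
  rewrite [leLHS]integral_mkcond; apply: ge0_le_integral_nomeas.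
    move=> v _; rewrite patchE; case: ifP => // _.
    by apply: integral_ge0 => th _; exact: hawkes_weight_ge0.
  move=> v _; rewrite patchE; case: ifPn => [/set_mem/=|_]; last first.
    by apply: integral_ge0 => z _; exact: f0.
  rewrite in_itv/= => /andP[v0 vt].
  rewrite (integral_mark_prm w v (h := fun z => weight n (w, z)))//; last first.
    by move=> z; exact: hawkes_weight_ge0.
  apply: ge0_subset_integral => //.
  - exact: measurable_strip.
  - exact: measurable_strip.
  - by apply: measurable_funTS; exact: measurableT_comp mf (pair2_measurable _).
  - by move=> z _; exact: (f0 (z, v)).
  - move=> [x y] [/= + y0]; rewrite /strip /= !in_itv/= => /andP[-> xv]; split => //.
    by rewrite (le_trans (ltW xv)).
rewrite -(tonelli_setX (prm_sigma_finite w) (lebesgue_sigma_finite R) _ _ f0 mf)//; last first.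
  exact: measurable_strip.
rewrite -ge0_integralZl//; last 4 first.
- exact: measurable_strip.
- by apply: measurable_funTS; exact: mwz.
- by move=> z _; exact: hawkes_weight_ge0.
- by apply: integral_ge0 => x _; rewrite lee_fin kernel_pos_ge0.
apply: ge0_le_integral_nomeas.
  by move=> z _; apply: integral_ge0 => v _; exact: f0.
move=> z _; rewrite /f /=.
under eq_integral do rewrite muleC.
rewrite ge0_integralZl//; last first.
- exact: hawkes_weight_ge0.
- by move=> v _; rewrite lee_fin kernel_pos_ge0.
- apply/measurable_EFinP; exact: measurableT_comp mphi (pair1_measurable z).
rewrite muleC (integral_translation (f := fun x => (phi x)%:E))//.
- by move=> x; rewrite lee_fin kernel_pos_ge0.
- by apply/measurable_EFinP; exact: measurable_kernel_pos.
Qed.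


Lemma moment0 t : (0 <= t)%R ->
  \int[P]_w \int[N w]_(z in strip `]0%R, t]) weight 0 (w, z) = (mu * t)%:E.
Proof.
move=> t0; have [sF Fm FS] := FP.
have FT : F 0%R setT.
  by apply/(measurable_sigma_algebraE (sF 0%R (lexx _))); exact: measurableT.
have mw := measurable_hawkes_weight N_poisson mu Phi_meas 0.
have w0 x : 0 <= weight 0 x by exact: hawkes_weight_ge0.
rewrite (campbell_between (lexx _) t0 FT)//.
transitivity (\int[P]_w (mu * t)%:E); last first.
  rewrite (_ : (fun=> _) = cst (mu * t)%:E)// integral_cst//.
  by rewrite -[RHS]mule1; congr (_ * _); exact: probability_setT.
apply: eq_integral => w _.
rewrite /strip (integral_product_setX (f := fun z => weight 0 (w, z)))//; last first.
  exact: measurable_section.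
transitivity (\int[leb]_(v in `]0%R, t]) mu%:E).
  apply: eq_integral => v /set_mem /=; rewrite in_itv/= => /andP[v0 _].
  under eq_integral do rewrite /= v0.
  by rewrite integral_mark// ltW.
rewrite (_ : (fun=> _) = cst mu%:E)// integral_cst//= lebesgue_measure_itv/= lte_fin.
case: ifPn => [_|]; first by rewrite sube0 EFinM.
by rewrite -leNgt => t0'; have -> : t = 0%R by apply/eqP; rewrite eq_le t0'.
Qed.

Hypothesis ratio_lt1 : branching_ratio < 1.

Lemma mean_hawkes_X t : (0 <= t)%R -> \int[P]_w hawkes_X N mu Phi t w < +oo.
Proof.
move=> t0.
have r0 : 0 <= branching_ratio.
  by apply: integral_ge0 => x _; rewrite lee_fin kernel_pos_ge0.
have rfin : branching_ratio \is a fin_num.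
  by rewrite ge0_fin_numE// (lt_trans ratio_lt1)// ltry.
pose q := fine branching_ratio.
have qE : branching_ratio = q%:E by rewrite /q fineK.
have q0 : (0 <= q)%R by rewrite fine_ge0.
have q1 : (q < 1)%R by rewrite -lte_fin -qE.
have bound n : \int[P]_w \int[N w]_(z in strip `]0%R, t]) weight n (w, z) <=
    (mu * t * q ^+ n)%:E.
  elim: n => [|n IH]; first by rewrite moment0// expr0 mulr1.
  apply: (le_trans (moment_le n t0)).
  by rewrite exprS mulrCA EFinM qE lee_wpmul2l// lee_fin.
have mterm n : measurable_fun setT
    (fun w => \int[N w]_(z in strip `]0%R, t]) weight n (w, z)).
  apply: (measurable_integral_prmT N_poisson (f := weight n)) => //.
  - exact: measurable_strip.
  - by move=> x; exact: hawkes_weight_ge0.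
  - apply: measurable_mpred_prod.
    exact: (measurable_hawkes_weight N_poisson mu Phi_meas).
have term0 n w : 0 <= \int[N w]_(z in strip `]0%R, t]) weight n (w, z).
  by apply: integral_ge0 => z _; exact: hawkes_weight_ge0.
rewrite (_ : hawkes_X N mu Phi t = (fun w =>
    \sum_(n <oo) \int[N w]_(z in strip `]0%R, t]) weight n (w, z))); last first.
  apply/funext => w; rewrite (hawkes_XE N_poisson mu Phi_meas).
  rewrite /hawkes_total integral_nneseries//.
  - exact: measurable_strip.
  - move=> n; apply: measurable_funTS; apply: measurable_section.
    exact: (measurable_hawkes_weight N_poisson mu Phi_meas).
  - by move=> n z _; exact: hawkes_weight_ge0.
rewrite integral_nneseries//.
apply: (@le_lt_trans _ _ (\sum_(n <oo) (mu * t * q ^+ n)%:E)).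
  by apply: lee_nneseries => [n _ _|n _]; [exact: integral_ge0|exact: bound].
have cvgq : cvgn (series (geometric (mu * t) q)).
  by apply: is_cvg_geometric_series; rewrite ger0_norm.
rewrite (_ : \sum_(n <oo) _ = (limn (series (geometric (mu * t) q)))%:E) ?ltry//.
rewrite -EFin_lim//; apply/congr_lim/funext => n.
by rewrite /= /series /= sumEFin.
Qed.

End moments.

(** * The measure of jumps *)

Section integer_valued_measures.
Local Open Scope ereal_scope.
Context dZ (Z : measurableType dZ) (R : realType).
Variable m : {measure set Z -> \bar R}.
Hypothesis em : forall B, measurable B -> enat (m B).

Lemma enat_lt1 (x : \bar R) : enat x -> x < 1 -> x = 0.
Proof.
move=> [->//|[k ->]]; rewrite lte_fin -[1%R]/(1%:R) ltr_nat.
by case: k.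
Qed.

(** Natural numbers that tend to 0 are eventually 0. *)
Lemma enat_measure_vanish (E : nat -> set Z) :
  (forall i j, (i <= j)%N -> E j `<=` E i) -> (forall k, measurable (E k)) ->
  \bigcap_k E k = set0 -> m (E 0%N) < +oo -> exists K, m (E K) = 0.
Proof.
move=> ndE mE capE E0oo.
have cvgE : m (E k) @[k --> \oo] --> m (\bigcap_k E k).
  apply: nonincreasing_cvg_mu => //; first by rewrite capE.
  by move=> i j ij; apply/subsetPset; exact: ndE.
rewrite capE measure0 in cvgE.
apply: contrapT => nK.
have m1 k : 1 <= m (E k).
  rewrite leNgt; apply/negP => mk1; apply: nK; exists k.
  exact: (enat_lt1 (em (mE k)) mk1).
have : 1 <= limn (m \o E).
  by apply: lime_ge; [apply/cvg_ex; exists 0|exact: nearW].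
by rewrite (cvg_lim _ cvgE)// lee_fin ler10.
Qed.

(* A finite integer-valued measure lives on finitely many points, so every
   finite function is integrable. *)
Lemma integral_enat_measure_lty (D : set Z) (h : Z -> \bar R) :
  measurable D -> m D < +oo ->
  measurable_fun setT h -> (forall z, D z -> 0 <= h z < +oo) ->
  \int[m]_(z in D) h z < +oo.
Proof.
move=> mD mDoo mh h0.
(* These sets decrease to the empty set because h is finite, so one of them is null and h is
   essentially bounded on D. *)
pose E (k : nat) := D `&` [set z | k%:R%:E < h z].
have mE k : measurable (E k).
  by apply: emeasurable_fun_o_infty => //; exact: measurable_funTS.
have capE : \bigcap_k E k = set0.
  apply/seteqP; split => // z Ez; have [Dz _] := Ez 0%N I.
  have /andP[hz0 hzoo] := h0 z Dz.
  have [_ /=] := Ez (Num.truncn (fine (h z))).+1 I.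
  by rewrite -[h z]fineK ?ge0_fin_numE// lte_fin fineK ?ge0_fin_numE// ltNge ltW// truncnS_gt.
have [K EK0] : exists K, m (E K) = 0.
  apply: (enat_measure_vanish _ mE capE) => //.
  - move=> i j ij; apply: setIS => z /=.
    by apply: le_lt_trans; rewrite lee_fin ler_nat.
  - apply: le_lt_trans mDoo; apply: le_measure; rewrite ?inE//.
    exact: subIsetl.
apply: (@le_lt_trans _ _ (K%:R%:E * m D)); last first.
  by rewrite lte_mul_pinfty.
rewrite (_ : \int[m]_(z in D) h z = \int[m]_(z in D `\` E K) h z); last first.
  by rewrite -ge0_negligible_integral//; [exact: measurable_funTS|move=> z /h0 /andP[]].
apply: (@le_trans _ _ (\int[m]_(z in D `\` E K) (K%:R%:E))).
  apply: ge0_le_integral_nomeas => z [Dz].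
    by have /andP[] := h0 z Dz.
  move=> nEK; rewrite leNgt; apply/negP => Kh; exact: nEK.
rewrite (_ : (fun=> _) = cst K%:R%:E)// integral_cst; last exact: measurableD.
rewrite lee_wpmul2l//; apply: le_measure; rewrite ?inE//; first exact: measurableD.
Qed.

End integer_valued_measures.

Section counting_path.
Context d (T : measurableType d) (R : realType) (P : probability T R).
Variable N : T -> {measure set (plane R) -> \bar R}.
Hypothesis N_poisson : is_poisson_random_measure P N.
Variables (mu : R) (Phi : R -> R).
Hypothesis Phi_meas : measurable_fun (`[0, +oo[%classic : set (measurableTypeR R)) Phi.
Local Open Scope ereal_scope.

Local Notation phi := (kernel_pos Phi).
Local Notation weight := (hawkes_weight N mu Phi).
Local Notation total := (hawkes_total N mu Phi).
Local Notation X := (hawkes_X N mu Phi).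

Variable w : T.

Let mtotal : measurable_fun setT (fun z : plane R => total (w, z)).
Proof.
apply: (measurable_mpred_section N_poisson).
exact: (measurable_hawkes_total N_poisson mu Phi_meas).
Qed.

Let mweight n : measurable_fun setT (fun z : plane R => weight n (w, z)).
Proof.
apply: (measurable_mpred_section N_poisson).
exact: (measurable_hawkes_weight N_poisson mu Phi_meas).
Qed.

Lemma measurable_level (f : plane R -> \bar R) j : measurable_fun setT f ->
  measurable [set z | j.+1%:R%:E <= f z].
Proof.
move=> mf; rewrite -[X in measurable X]setTI.
exact: emeasurable_fun_c_infty.
Qed.

Lemma enat_integral_prm (D : set (plane R)) (f : plane R -> \bar R) :
  measurable D -> measurable_fun setT f -> (forall z, D z -> enat (f z)) ->
  enat (\int[N w]_(z in D) f z).
Proof.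
move=> mD mf ef.
have -> : \int[N w]_(z in D) f z = \sum_(j <oo) N w ([set z | j.+1%:R%:E <= f z] `&` D).
  pose E j := [set z | j.+1%:R%:E <= f z].
  transitivity (\int[N w]_(z in D) \sum_(j <oo) (\1_(E j) z)%:E).
    apply: eq_integral => z /set_mem Dz; rewrite [LHS]enat_levels; last exact: ef.
    apply: eq_eseriesr => j _; rewrite indicE; case: ifPn => jf.
      by rewrite mem_set.
    by rewrite memNset//; exact/negP.
  rewrite integral_nneseries//; last first.
    move=> j; apply: measurable_funTS; apply/measurable_EFinP.
    by apply: measurable_indic; exact: measurable_level.
  by apply: eq_eseriesr => j _; rewrite integral_indic//; exact: measurable_level.
apply: enat_series => j; apply: (prm_enat N_poisson).
by apply: measurableI => //; exact: measurable_level.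
Qed.

Lemma enat_bool (b : bool) : enat (b%:R%:E : \bar R).
Proof. by case: b; [exact: (enat_nat R 1)|exact: (enat_nat R 0)]. Qed.

Lemma enat_weight n z : enat (weight n (w, z)).
Proof.
elim: n z => [|n IH] z /=.
  by case: ifP => _; [exact: enat_bool|exact: (enat_nat R 0)].
apply: enat_integral_prm => [| |z' _].
- exact: measurable_strip.
- apply: emeasurable_funM; last exact: mweight.
  apply/measurable_EFinP.
  apply: (measurableT_comp (f := fun b : bool => (b%:R : R))) => //.
  apply: measurable_fun_ler; first exact: measurable_cst.
  apply: measurableT_comp (measurable_kernel_pos Phi_meas) _.
  exact: measurable_funB.
- by case: (_ <= _)%R; rewrite ?mul1e ?mul0e//; exact: (enat_nat R 0).
Qed.

Lemma enat_total z : enat (total (w, z)).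
Proof. by apply: enat_series => n; exact: enat_weight. Qed.

Let level j : set (plane R) :=
  strip `]0%R, +oo[ `&` [set z | j.+1%:R%:E <= total (w, z)].

Let mlevel j : measurable (level j).
Proof.
by apply: measurableI; [exact: measurable_strip|exact: measurable_level].
Qed.

(* The image of total(w, .) dN(w) under the time coordinate, summed over the
   levels of the natural-valued function total(w, .). *)
Definition jump_measure : {measure set (measurableTypeR R) -> \bar R} :=
  mseries (fun j => image_measure (mrestr (N w) (mlevel j))
    (@measurable_fst _ _ (measurableTypeR R) (measurableTypeR R))) 0.

(** Summing over the levels restores [total] by [enat_levels]. Only positive times are allowed,
    since the levels are cut to them. *)
Lemma integral_jump_measure (B : set (measurableTypeR R)) (f : R -> R) :
  measurable B -> B `<=` `]0%R, +oo[ ->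
  (forall r, (0 <= f r)%R) -> measurable_fun setT f ->
  \int[jump_measure]_(r in B) (f r)%:E =
  \int[N w]_(z in B `*` `[0%R, +oo[) ((f z.1)%:E * total (w, z)).
Proof.
move=> mB B0 f0 mf.
have mff : measurable_fun setT (fun z : plane R => (f z.1)%:E).
  by apply/measurable_EFinP; exact: measurableT_comp mf measurable_fst.
have mfE : measurable_fun setT (EFin \o f) by exact/measurable_EFinP.
have f0E r : 0 <= (f r)%:E by rewrite lee_fin.
rewrite ge0_integral_measure_series//; last exact: measurable_funTS.
have mBS : measurable (B `*` `[0%R, +oo[ : set (plane R)) by exact: measurableX.
transitivity (\sum_(j <oo) \int[N w]_(z in B `*` `[0%R, +oo[)
    ((f z.1)%:E * (if j.+1%:R%:E <= total (w, z) then 1 else 0))).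
  apply: eq_eseriesr => j _.
  rewrite ge0_integral_image_measure//; last exact: measurable_funTS.
  rewrite integral_mkcond integral_mrestr; last 2 first.
  - by move=> z; rewrite patchE; case: ifP.
  - apply/(measurable_restrictT _ _).1; last exact: measurable_funTS.
    by rewrite -[X in measurable X]setTI; exact: measurable_fst.
  rewrite integral_mkcond [RHS]integral_mkcond; apply: eq_integral => -[v th] _.
  rewrite !patchE; case: ifPn => [/set_mem[[/= v0 th0] lv]|nl].
    case: ifPn => [/set_mem/= Bv|Bv].
      by rewrite mem_set//= lv mule1.
    by rewrite memNset// => -[/= hB _]; move: Bv; rewrite mem_set.
  case: ifPn => // /set_mem[/= Bv th0]; case: ifPn => [lv|]; last by rewrite mule0.
  by move: nl; rewrite mem_set//; split => //; split => //; exact: B0.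
rewrite -integral_nneseries//.
- apply: eq_integral => z _.
  rewrite [in RHS](enat_levels (enat_total z)).
  by rewrite nneseriesZl// => j _; case: ifP.
- move=> j; apply: measurable_funTS; apply: emeasurable_funM => //.
  apply: measurable_fun_ifT => //.
  by apply: measurable_fun_lee.
- by move=> j z _; rewrite mule_ge0//; case: ifP.
Qed.

Lemma jump_measureE (B : set (measurableTypeR R)) : measurable B -> B `<=` `]0%R, +oo[ ->
  jump_measure B = \int[N w]_(z in B `*` `[0%R, +oo[) total (w, z).
Proof.
move=> mB B0; transitivity (\int[jump_measure]_(r in B) (cst 1%:E r)).
  by rewrite integral_cst// mul1e.
rewrite (integral_jump_measure (f := cst 1%R))//.
by apply: eq_integral => z _; rewrite mul1e.
Qed.

Lemma hawkes_X_jump t : X t w = jump_measure `]0%R, t]%classic.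
Proof.
rewrite (hawkes_XE N_poisson mu Phi_meas) jump_measureE//.
by move=> r /=; rewrite !in_itv/= andbT => /andP[].
Qed.

Lemma enat_jump_measure B : measurable B -> enat (jump_measure B).
Proof.
move=> mB; apply: enat_series => j; apply: (prm_enat N_poisson).
apply: measurableI => //; rewrite -[X in measurable X]setTI.
exact: measurable_fst.
Qed.

Lemma prm_bounded_lty (t c : R) : N w ([set t] `*` `[0%R, c]) < +oo.
Proof.
set n := (Num.truncn (Num.max t c)).+1.
rewrite (prm_setI_quadrant N_poisson); last exact: measurableX.
apply: (@le_lt_trans _ _ (N w (setT `&` square n))); last first.
  by have [k ->] := prm_square_enat N_poisson w n measurableT; rewrite ltry.
apply: le_measure; rewrite ?inE.
- by apply: measurableI; [exact: measurableX|exact: measurable_quadrant].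
- by rewrite setTI; exact: measurable_square.
move=> [x y] [[/= -> yc] [/= t0 _]]; split => //.
have := truncnS_gt (Num.max t c); rewrite gt_max => /andP[/ltW ht /ltW hc].
move: t0 yc; rewrite /square/= !in_itv/= andbT => -> /andP[-> yc].
by rewrite ht (le_trans yc).
Qed.

(** For each w, the mass at t is the number of atoms at t with mark at most mu, plus the integral
    over earlier jumps r of the number of atoms at t with mark at most phi(t - r). These numbers are
    finite, and a finite integer-valued measure integrates any finite function to a finite value. *)
Lemma explosion_left t : (0 < t)%R ->
  jump_measure `]0%R, t[%classic < +oo -> jump_measure `]0%R, t]%classic < +oo.
Proof.
move=> t0 left_fin.
rewrite (_ : `]0%R, t]%classic = `]0%R, t[%classic `|` [set t]); last first.
  apply/seteqP; split => x /=; rewrite !in_itv/=.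
    by move=> /andP[-> /=]; rewrite le_eqVlt => /predU1P[|]; [right|left].
  by move=> [/andP[-> /ltW]//|->]; rewrite t0 lexx.
have -> : jump_measure (`]0%R, t[%classic `|` [set t]) =
    jump_measure `]0%R, t[%classic + jump_measure [set t].
  apply: measureU => //; apply/seteqP; split => // x [/= xt xE].
  by move: xt; rewrite xE in_itv/= ltxx andbF.
rewrite lte_add_pinfty//.
have S0 : [set t] `<=` `]0%R, +oo[ by move=> _ ->; rewrite /= in_itv/= t0.
rewrite jump_measureE//.
have mStrip : measurable ([set t] `*` `[0%R, +oo[ : set (plane R)) by exact: measurableX.
pose f (x : plane R * plane R) : \bar R :=
  (x.1.2 <= phi (t - x.2.1))%R%:R%:E * total (w, x.2).
have f0 x : 0 <= f x by rewrite mule_ge0// ?hawkes_total_ge0// lee_fin.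
have mphi : measurable_fun setT (fun z : plane R => phi (t - z.1)).
  apply: measurableT_comp (measurable_kernel_pos Phi_meas) _.
  exact: measurable_funB.
have mf : measurable_fun setT f.
  apply: emeasurable_funM; last exact: measurableT_comp mtotal measurable_snd.
  apply/measurable_EFinP.
  apply: (measurableT_comp (f := fun b : bool => (b%:R : R))) => //.
  apply: measurable_fun_ler; first exact: measurableT_comp measurable_snd measurable_fst.
  exact: measurableT_comp mphi measurable_snd.
rewrite (eq_integral (fun z : plane R => (z.2 <= mu)%R%:R%:E +
    \int[N w]_(z' in strip `]0%R, t[) f (z, z'))); last first.
  move=> [v th] /set_mem[/= -> th0]; rewrite (hawkes_total_rec N_poisson mu Phi_meas)//.
have mmark (c : R) : measurable_fun setT (fun z : plane R => (z.2 <= c)%R%:R%:E : \bar R).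
  apply/measurable_EFinP.
  apply: (measurableT_comp (f := fun b : bool => (b%:R : R))) => //.
  by apply: measurable_fun_ler => //; exact: measurable_snd.
have count (c : R) : \int[N w]_(z in [set t] `*` `[0%R, +oo[) (z.2 <= c)%R%:R%:E =
    N w ([set t] `*` `[0%R, c]).
  transitivity (\int[N w]_(z in [set t] `*` `[0%R, +oo[) (\1_([set t] `*` `[0%R, c]) z)%:E).
    apply: eq_integral => -[v th] /set_mem[/= ->]; rewrite in_itv/= andbT => th0.
    rewrite indicE; have [thc|thc] := boolP (th <= c)%R.
      by rewrite mem_set//= in_itv/= th0.
    by rewrite memNset// => -[/= _]; rewrite in_itv/= th0 (negbTE thc).
  rewrite integral_indic//; last exact: measurableX.
  congr (N w _); apply/seteqP; split => [z []//|[v th] [/= -> thc]]; split => //; split => //=.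
  by move: thc; rewrite !in_itv/= andbT => /andP[].
rewrite ge0_integralD//; last 3 first.
- exact: measurable_funTS.
- by move=> z _; apply: integral_ge0.
- apply: measurable_funTS.
  apply: (measurable_integral_param (f := f) (prm_sigma_finite N_poisson w)) => //.
  exact: measurable_strip.
rewrite lte_add_pinfty// ?count ?prm_bounded_lty//.
rewrite (tonelli_setX (prm_sigma_finite N_poisson w) (prm_sigma_finite N_poisson w))//; last first.
  exact: measurable_strip.
(* The number of atoms at t that a jump at r triggers; finite for each r, with no bound uniform in
   r. *)
pose h (r : R) : R := fine (N w ([set t] `*` `[0%R, phi (t - r)%R])).
have hE r : (h r)%:E = N w ([set t] `*` `[0%R, phi (t - r)%R]).
  by rewrite /h fineK// ge0_fin_numE// prm_bounded_lty.
have h0 r : (0 <= h r)%R by rewrite fine_ge0.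
have mh : measurable_fun setT h.
  apply: measurableT_comp => //.
  rewrite (_ : (fun r => _) = (fun r => \int[N w]_(z in [set t] `*` `[0%R, +oo[)
      (z.2 <= phi (t - r))%R%:R%:E)); last by apply/funext => r; rewrite count.
  pose g (x : measurableTypeR R * plane R) : \bar R := (x.2.2 <= phi (t - x.1))%R%:R%:E.
  apply: (measurable_integral_param (f := g) (prm_sigma_finite N_poisson w)) => //.
    by move=> x; rewrite lee_fin.
  apply/measurable_EFinP.
  apply: (measurableT_comp (f := fun b : bool => (b%:R : R))) => //.
  apply: measurable_fun_ler; first exact: measurableT_comp measurable_snd measurable_snd.
  apply: measurableT_comp (measurable_kernel_pos Phi_meas) _.
  exact: measurable_funB.
rewrite (_ : \int[N w]_(y in strip `]0%R, t[) _ =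
    \int[jump_measure]_(r in `]0%R, t[) (h r)%:E).
  apply: (integral_enat_measure_lty enat_jump_measure) => //.
  - exact/measurable_EFinP.
  - by move=> r _; rewrite lee_fin h0 ltry.
rewrite integral_jump_measure//; last first.
  by move=> r /=; rewrite !in_itv/= andbT => /andP[].
apply: eq_integral => z' _; rewrite /f /=.
under eq_integral do rewrite muleC.
have t0' := enat_ge0 (enat_total z').
rewrite ge0_integralZl//.
- by rewrite count hE muleC.
- exact: measurable_funTS.
Qed.

End counting_path.

(** * Paths *)

Section distribution_function.
Local Open Scope ereal_scope.
Context (R : realType) (m : {measure set (measurableTypeR R) -> \bar R}).
Hypothesis em : forall B, measurable B -> enat (m B).

Let measure_itv_ge (a b : R) : (b <= a)%R -> m `]a, b]%classic = 0.
Proof. by move=> ba; rewrite set_itv_ge ?measure0// bnd_simp -leNgt. Qed.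

Let measure_itv_cat (a b c : R) : (a <= b)%R -> (b <= c)%R ->
  m `]a, c]%classic = m `]a, b]%classic + m `]b, c]%classic.
Proof.
move=> ab bc; rewrite -measureU//.
  congr (m _); apply/seteqP; split => x /=; rewrite !in_itv/=.
    by move=> /andP[ax xc]; have [xb|bx] := leP x b; [left; rewrite ax|right].
  by move=> [/andP[-> /le_trans->]//|/andP[bx ->]]; rewrite (le_lt_trans ab).
apply/seteqP; split => // x [] /=; rewrite !in_itv/= => /andP[_ xb] /andP[].
by rewrite ltNge xb.
Qed.

Lemma measure_itv_le (a b c : R) : (b <= c)%R ->
  m `]a, b]%classic <= m `]a, c]%classic.
Proof.
move=> bc; apply: le_measure; rewrite ?inE// => x /=; rewrite !in_itv/=.
by move=> /andP[-> /le_trans->].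
Qed.

(** The intervals just to the right of r shrink to the empty set, so one of them carries no mass. *)
Lemma distribution_right_constant (a b r : R) :
  m `]a, b]%classic < +oo -> (a <= r)%R ->
  exists2 e : R, (0 < e)%R & forall s, (r <= s < r + e)%R -> (s <= b)%R ->
    m `]a, s]%classic = m `]a, r]%classic.
Proof.
move=> mab ar.
pose E (k : nat) : set (measurableTypeR R) := `]r, (r + k.+1%:R^-1)%R] `&` `]a, b].
have mE k : measurable (E k) by exact: measurableI.
have capE : \bigcap_k E k = set0.
  apply/seteqP; split => // x Ex.
  have [+ _] := Ex 0%N I; rewrite /= in_itv/= => /andP[rx _].
  have xr : (0 < x - r)%R by rewrite subr_gt0.
  have [+ _] := Ex (Num.truncn (x - r)^-1) I; rewrite /= in_itv/= => /andP[_ h].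
  move: h; rewrite addrC -lerBlDr leNgt => /negP; apply.
  by rewrite invf_plt ?posrE// truncnS_gt.
have [K EK0] : exists K, m (E K) = 0.
  apply: (enat_measure_vanish em _ mE capE) => //.
    move=> i j ij x [+ abx]; rewrite /E/= !in_itv/= => /andP[rx h]; split => //=.
    rewrite rx/= (le_trans h)// lerD2l lef_pV2 ?posrE ?ltr0n//.
    by rewrite ler_nat ltnS.
  apply: le_lt_trans mab; apply: le_measure; rewrite ?inE//.
  exact: subIsetr.
exists (K.+1%:R^-1)%R => // s /andP[rs sK] sb.
rewrite (measure_itv_cat ar rs) (_ : m `]r, s]%classic = 0) ?adde0//.
apply/eqP; rewrite eq_le measure_ge0 andbT -EK0.
apply: le_measure; rewrite ?inE// => x /=; rewrite !in_itv/= => /andP[rx xs].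
by rewrite /E /= !in_itv/= rx (le_trans xs (ltW sK)) (le_lt_trans ar rx) (le_trans xs sb).
Qed.

(** The jump times are the first times at which the path reaches 1, ..., k, with k its value at S.
    If the path increases between a and b, the first time it reaches its value at b lies in ]a,
    b]. *)
Lemma distribution_piecewise_constant : (forall t, m `]0%R, t]%classic < +oo) ->
  piecewise_constant (fun t => m `]0%R, t]%classic).
Proof.
move=> moo S S0.
have mk t : exists k, m `]0%R, t]%classic = k%:R%:E.
  by have [moo'|//] := em (measurable_itv `]0%R, t]); have := moo t; rewrite moo'.
have [k kE] := mk S.
pose A (i : nat) : set R := [set r | (0 <= r <= S)%R /\ i%:R%:E <= m `]0%R, r]%classic].
exists [seq inf (A i) | i <- iota 1 k] => a b a0 ab bS noJ.
apply/eqP; rewrite eq_le measure_itv_le//= leNgt; apply/negP => xab.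
have [j jE] := mk b.
have bA : A j b by rewrite /A/= jE lexx bS (le_trans a0 ab).
have Aa : lbound (A j) a.
  move=> r [/andP[r0 rS] jr]; rewrite leNgt; apply/negP => ra.
  by have := lt_le_trans xab (le_trans (_ : _ <= j%:R%:E) jr); rewrite jE lexx => /(_ isT);
    rewrite ltNge measure_itv_le// ltW.
have [e e0 ae] := distribution_right_constant (moo S) a0.
have jJ : inf (A j) \in [seq inf (A i) | i <- iota 1 k].
  apply/mapP; exists j => //; rewrite mem_iota add1n ltnS.
  have -> /= : (0 < j)%N.
    by rewrite -(ltr_nat R) -lte_fin -jE (le_lt_trans _ xab)// measure_ge0.
  by rewrite -(ler_nat R) -lee_fin -jE -kE measure_itv_le.
apply/negP: (noJ _ jJ); rewrite negbK; apply/andP; split.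
  (* The path stays at its value at a on [a, a + e[, so the infimum is strictly larger than a. *)
  apply: (@lt_le_trans _ _ (a + e)%R); first by rewrite ltrDl.
  apply: lb_le_inf; first by exists b.
  move=> r [/andP[r0 rS] jr]; rewrite leNgt; apply/negP => re.
  have ar : (a <= r)%R by apply: Aa; split => //; rewrite r0.
  have := ae r; rewrite ar re => /(_ isT rS) rE.
  by move: jr; rewrite rE -jE leNgt xab.
by apply: ge_inf => //; exists a.
Qed.

Let x t r := fine (m `]0%R, Num.min r t]%classic).

Let xE t r : m `]0%R, t]%classic < +oo -> (x t r)%:E = m `]0%R, Num.min r t]%classic.
Proof.
move=> mt; rewrite fineK// ge0_fin_numE//; apply: le_lt_trans mt.
by apply: measure_itv_le; rewrite ge_min lexx orbT.
Qed.

Let x_nd t : m `]0%R, t]%classic < +oo -> {homo x t : r s / (r <= s)%R}.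
Proof.
move=> mt r s rs; rewrite -lee_fin !xE//; apply: measure_itv_le.
by rewrite le_min !ge_min rs lexx orbT.
Qed.

Let x_rc t : m `]0%R, t]%classic < +oo -> right_continuous (x t).
Proof.
move=> mt r; suff : \forall s \near r^'+, x t s = x t r.
  by move=> xs; apply: cvg_near_cst; apply: filterS xs => s ->.
have [r0|r0] := ltP r 0%R.
  near=> s; rewrite /x !measure_itv_ge// ge_min ?(ltW r0)//.
  by apply/orP; left; near: s; exact: nbhs_right_le.
have [e e0 re] := distribution_right_constant mt r0.
have [rt|tr] := leP r t; last first.
  near=> s; rewrite /x (min_r (ltW tr)) min_r//.
  by apply: (le_trans (ltW tr)); near: s; exact: nbhs_right_ge.
near=> s; rewrite /x (min_l rt) re//; last by rewrite ge_min lexx orbT.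
rewrite le_min rt andbT; apply/andP; split.
  by near: s; exact: nbhs_right_ge.
rewrite gt_min; apply/orP; left; near: s; apply: nbhs_right_lt.
by rewrite ltrDl.
Unshelve. all: by end_near. Qed.

Lemma lebesgue_stieltjes_measureE (f : cumulative R R)
    (m' : {measure set (measurableTypeR R) -> \bar R}) :
  (forall a b, (a <= b)%R -> m' `]a, b]%classic = (f b - f a)%:E) ->
  forall A, measurable A -> lebesgue_stieltjes_measure f A = m' A.
Proof.
move=> m'E A mA; apply: lebesgue_stieltjes_measure_unique => [I [[a b]]/= _ <- | //].
rewrite /lebesgue_stieltjes_measure /measure_extension/=.
rewrite measurable_mu_extE/=; last exact: is_ocitv.
have [ab | ba] := leP a b; last first.
  by rewrite set_itv_ge ?wlength0 ?measure0// bnd_simp -leNgt ltW.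
by rewrite wlength_itv_bnd// m'E.
Qed.

(** The stopped path is nondecreasing and right-continuous, and it is constant outside ]0, t]; its
    Stieltjes measure is m restricted to this interval. *)
Lemma stieltjes_distribution (t : R) (A : set (measurableTypeR R)) :
  measurable A -> (forall r : R, A r -> (0 < r <= t)%R) ->
  m `]0%R, t]%classic < +oo ->
  stieltjes (fun r => fine (m `]0%R, Num.min r t]%classic)) A = m A.
Proof.
move=> mA At mt; rewrite /stieltjes; case: pselect => [h|[]]; last first.
  by split; [exact: x_nd|exact: x_rc].
have mI : measurable (`]0%R, t]%classic : set (measurableTypeR R)) by [].
transitivity (mrestr m mI A); last first.
  rewrite /mrestr; congr (m _); apply/setIidPl => r /At.
  by rewrite /= in_itv.
apply: lebesgue_stieltjes_measureE mA => a b ab /=; rewrite EFinB !(xE _ mt).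
rewrite (_ : m `]0%R, Num.min b t]%classic =
    m `]0%R, Num.min a t]%classic + mrestr m mI `]a, b]%classic).
  by rewrite addeAC -(xE a mt) subee// add0e.
rewrite /= /mrestr -measureU//; last 2 first.
- exact: measurableI.
- apply/seteqP; split => // r [] /=; rewrite !in_itv/= le_min.
  by move=> /andP[_ /andP[ra _]] [/andP[]]; rewrite ltNge ra.
congr (m _); apply/seteqP; split => r /=; rewrite !in_itv/= !le_min.
  move=> /and3P[-> -> ->]; rewrite !andbT/=.
  by have [ra|ar] := leP r a; [left|right].
by move=> [/and3P[-> ra ->]|[/andP[_ ->] /andP[-> ->]]//]; rewrite (le_trans ra ab).
Qed.

(** [fine] sends +oo to 0, so the stopped path is 0 from t on. If it is monotone it is therefore
    identically 0; otherwise [stieltjes] is the zero measure by definition. *)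
Lemma stieltjes_infinite (t : R) (A : set (measurableTypeR R)) :
  measurable A -> m `]0%R, t]%classic = +oo -> (forall r : R, A r -> (r <= t)%R) ->
  stieltjes (fun r => fine (m `]0%R, Num.min r t]%classic)) A = 0.
Proof.
move=> mA mt At; rewrite /stieltjes; case: pselect => [h|//].
have xt : x t t = 0%R by rewrite /x minxx mt.
apply: (lebesgue_stieltjes_measureE (m' := mzero)) mA => a b ab.
have x0 r : x t r = 0%R.
  apply/eqP; rewrite eq_le fine_ge0// andbT.
  have [rt|/ltW tr] := leP r t; first by rewrite -[leRHS]xt; exact: h.1.
  by rewrite /x (min_r tr) mt.
by rewrite /= -![fine _]/(x t _) !x0 subrr.
Qed.

End distribution_function.

Section intensity_path.
Context d (T : measurableType d) (R : realType) (P : probability T R).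
Variable N : T -> {measure set (plane R) -> \bar R}.
Hypothesis N_poisson : is_poisson_random_measure P N.
Variables (mu : R) (Phi : R -> R).
Hypothesis Phi_meas : measurable_fun (`[0, +oo[%classic : set (measurableTypeR R)) Phi.
Local Open Scope ereal_scope.

Local Notation phi := (kernel_pos Phi).
Local Notation jumps := (jump_measure N_poisson mu Phi_meas).

(** Valid for every w. By [explosion_left], the test whether X_t is finite becomes a test on ]0, t[,
    so only the strict past of t remains. *)
Lemma hawkes_intensityE t w : hawkes_intensity N mu Phi t w =
  mu%:E + if jumps w `]0%R, t[%classic < +oo then
    \int[jumps w]_(r in `]0%R, t[) (phi (t - r))%:E else 0.
Proof.
have em := enat_jump_measure N_poisson mu Phi_meas w.
rewrite /hawkes_intensity; congr (_ + _).
rewrite (_ : (fun r => _) = fun r => fine (jumps w `]0%R, Num.min r t]%classic)); last first.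
  by apply/funext => r; rewrite (hawkes_X_jump N_poisson mu Phi_meas).
have [t0|t0] := ltP 0%R t; last first.
  by rewrite set_itv_ge ?bnd_simp -?leNgt// !integral_set0; case: ifP.
case: ifPn => left_fin.
  rewrite (eq_measure_integral (jumps w)) => [|A mA At].
    apply: eq_integral => r /set_mem; rewrite /= in_itv/= => /andP[_ rt].
    by rewrite kernel_posE// subr_ge0 ltW.
  rewrite (stieltjes_distribution em)//.
    by move=> r /At; rewrite /= in_itv/= => /andP[-> /ltW].
  exact: explosion_left.
rewrite (eq_measure_integral mzero) => [|A mA At]; first exact: integral_measure_zero.
rewrite stieltjes_infinite//.
  apply/eqP; rewrite -leye_eq; move: left_fin; rewrite -leNgt => /le_trans; apply.
  apply: le_measure; rewrite ?inE// => r /=; rewrite !in_itv/=.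
  by move=> /andP[-> /ltW].
by move=> r /At; rewrite /= in_itv/= => /andP[_ /ltW].
Qed.

End intensity_path.

(** * Predictability of the intensity *)

(** With these generators, the jumps in ]-oo, x] up to time q are counted by X at the smaller of x
    and q. *)
Lemma measurable_closed_raysE (R : realType) :
  @measurable _ (measurableTypeR R) = <<s [set `]-oo, x]%classic | x in [set: R]] >>.
Proof.
apply/seteqP; split; last first.
  apply: smallest_sub; first exact: sigma_algebra_measurable.
  by move=> _ [x _ <-] /=; exact: measurable_itv.
rewrite [X in X `<=` _]RGenInftyO.measurableE.
apply: smallest_sub => [|_ [x ->]]; first exact: smallest_sigma_algebra.
have -> : `]-oo, x[%classic = \bigcup_n `]-oo, x - n.+1%:R^-1]%classic.
  apply/seteqP; split => [y|y [n _]] /=; rewrite !in_itv/= => yx; last first.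
    by rewrite (le_lt_trans yx)// ltrBlDr ltrDl.
  exists (Num.truncn (x - y)^-1) => //=; rewrite in_itv/= lerBrDr -lerBrDl ltW//.
  by rewrite invf_plt ?posrE// ?truncnS_gt ?subr_gt0.
have [_ _ sU] := @smallest_sigma_algebra R setT [set `]-oo, x]%classic | x in [set: R]].
apply: sU => n.
by apply: sub_sigma_algebra; exists (x - n.+1%:R^-1).
Qed.

Section predictable_intensity.
Context d (T : measurableType d) (R : realType) (P : probability T R).
Variable N : T -> {measure set (plane R) -> \bar R}.
Hypothesis N_poisson : is_poisson_random_measure P N.
Variables (mu : R) (Phi : R -> R).
Hypothesis Phi_ge0 : forall x, 0 <= x -> 0 <= Phi x.
Hypothesis Phi_meas : measurable_fun (`[0, +oo[%classic : set (measurableTypeR R)) Phi.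
Local Open Scope ereal_scope.

Local Notation phi := (kernel_pos Phi).
Local Notation X := (hawkes_X N mu Phi).
Local Notation jumps := (jump_measure N_poisson mu Phi_meas).
Local Notation G := (natural_filtration X).
Local Notation Y := (mpred G).

Let XE t w : X t w = jumps w `]0%R, t]%classic.
Proof. exact: hawkes_X_jump. Qed.

Lemma natural_filtration_sub t : G t `<=` prm_filtration N t.
Proof.
have [sF Fm FS] := prm_filtrationP N_poisson.
have [t0|t0] := leP 0%R t.
  apply: smallest_sub; first exact: sF.
  move=> _ [s [B [/andP[s0 st] mB ->]]]; apply: (FS _ _ s0 st).
  exact: (hawkes_X_adapted N_poisson mu Phi_meas s0).
apply: smallest_sub; first exact: smallest_sigma_algebra.
move=> _ [s [B [/andP[s0 st] mB ->]]].
by have := lt_le_trans t0 (le_trans s0 st); rewrite ltxx.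
Qed.

Lemma natural_filtrationP : is_filtration G.
Proof.
have [sF Fm FS] := prm_filtrationP N_poisson.
split => [t _|t t0|s t s0 st].
- exact: smallest_sigma_algebra.
- by apply: subset_trans (Fm _ t0); exact: natural_filtration_sub.
- apply: smallest_sub; first exact: smallest_sigma_algebra.
  move=> _ [r [B [/andP[r0 rs] mB ->]]]; apply: sub_sigma_algebra.
  by exists r, B; split => //; rewrite r0 (le_trans rs).
Qed.

Lemma natural_adapted q r : (r <= q)%R -> measurable_wrt (G q) (X r).
Proof.
move=> rq B mB; have [r0|r0] := leP 0%R r.
  by apply: sub_sigma_algebra; exists r, B; rewrite r0 rq.
have -> : X r = cst 0.
  by apply/funext => w; rewrite XE set_itv_ge ?measure0// bnd_simp -leNgt ltW.
have /measurable_wrtP : sigma_algebra setT (G q) by exact: smallest_sigma_algebra.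
by move=> /(_ R (cst 0))[_]; apply => //; exact: measurable_cst.
Qed.

(** Jumps on ]0, v[ as left limits of the jumps on ]0, q]. *)
Lemma measurable_jumps_before (U : set (measurableTypeR R)) : measurable U ->
  (forall q, (0 <= q)%R -> measurable_wrt (G q) (fun w => jumps w (U `&` `]0%R, q]))) ->
  measurable_fun setT (fun y : Y => jumps y.1 (U `&` `]0%R, y.2.1[)).
Proof.
move=> mU aU.
apply: (measurable_left_limit (a := fun q w => jumps w (U `&` `]0%R, q]))) => //.
- move=> w q r q0 qr; apply: le_measure; rewrite ?inE; [exact: measurableI..|].
  by apply: setIS => x /=; rewrite !in_itv/= => /andP[-> /le_trans->].
- move=> y; apply: (measure_left_limit (jumps y.1)
    (f := (id : measurableTypeR R -> R)) _ mU); exact: (@measurable_id _ _ setT).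
Qed.

Let jumps_left : measurable_fun setT (fun y : Y => jumps y.1 `]0%R, y.2.1[%classic).
Proof.
under eq_fun do rewrite -(setTI `]0%R, _[%classic).
apply: measurable_jumps_before => // q q0.
rewrite (_ : (fun w => _) = X q); last by apply/funext => w; rewrite setTI XE.
exact: natural_adapted.
Qed.

Let mI (y : Y) : measurable (`]0%R, y.2.1[%classic : set (measurableTypeR R)).
Proof. by []. Qed.

(** The measure that the intensity at v integrates against. Its vanishing on infinite pasts matches
    [hawkes_intensityE] and keeps it finite, as the monotone class argument requires. *)
Let kappa (y : Y) : {measure set (measurableTypeR R) -> \bar R} :=
  if jumps y.1 `]0%R, y.2.1[%classic < +oo
  then mrestr (jumps y.1) (mI y) : {measure set (measurableTypeR R) -> \bar R}
  else mzero.

Let kappaE (y : Y) U : kappa y U =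
  if jumps y.1 `]0%R, y.2.1[%classic < +oo then jumps y.1 (U `&` `]0%R, y.2.1[)
  else 0.
Proof. by rewrite /kappa; case: ifP. Qed.

Let kappa_fin (y : Y) : kappa y setT < +oo.
Proof. by rewrite kappaE setTI; case: ifPn => // _; rewrite ltry. Qed.

Let measurable_kappa U : measurable U -> measurable_fun setT (kappa ^~ U).
Proof.
have mif (V : set (measurableTypeR R)) : measurable V ->
    (forall q, (0 <= q)%R -> measurable_wrt (G q) (fun w => jumps w (V `&` `]0%R, q]))) ->
    measurable_fun setT (kappa ^~ V).
  move=> mV aV; under eq_fun do rewrite kappaE.
  apply: measurable_fun_ifT => //; last exact: measurable_jumps_before.
  by apply: measurable_fun_lte.
apply: (measurable_measure_of_generator (measurable_closed_raysE R) _ kappa_fin).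
- move=> _ _ [x _ <-] [y _ <-]; exists (Num.min x y) => //.
  by apply/seteqP; split => z /=; rewrite !in_itv/= le_min => /andP.
- apply: mif => // q q0.
  rewrite (_ : (fun w => _) = X q); last by apply/funext => w; rewrite setTI XE.
  exact: natural_adapted.
- move=> _ [x _ <-]; apply: mif => // q q0.
  rewrite (_ : (fun w => _) = X (Num.min x q)).
    by apply: natural_adapted; rewrite ge_min lexx orbT.
  apply/funext => w; rewrite XE; congr (jumps w _).
  apply/seteqP; split => z /=; rewrite !in_itv/= le_min.
    by move=> [-> /andP[-> ->]].
  by move=> /and3P[-> -> ->].
Qed.

Lemma measurable_intensity :
  measurable_fun setT (fun y : Y => hawkes_intensity N mu Phi y.2.1 y.1).
Proof.
pose f (x : Y * measurableTypeR R) : \bar R := (phi ((positive_part_plane x.1.2).1 - x.2))%:E.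
rewrite (_ : (fun y => _) = (fun y => mu%:E + \int[kappa y]_r f (y, r))).
  apply: emeasurable_funD; first exact: measurable_cst.
  pose E (n : nat) : set (measurableTypeR R) := if n is 0%N then setT else set0.
  apply: (measurable_integral_cover (E := E)) => //.
  - by move=> [|i]; [exact: measurableT|exact: measurable0].
  - by apply/trivIsetP => -[|i] [|j] //= _ _ _; rewrite ?setI0 ?set0I.
  - by apply/seteqP; split => // x _; exists 0%N.
  - by move=> y [|i] /=; rewrite ?measure0.
  - by move=> yz; rewrite lee_fin kernel_pos_ge0.
  - apply/measurable_EFinP; apply: measurableT_comp (measurable_kernel_pos Phi_meas) _.
    apply: measurable_funB; last exact: measurable_snd.
    apply: measurableT_comp measurable_fst _.
    exact: measurableT_comp (measurable_mark natural_filtrationP) measurable_fst.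
apply/funext => y; rewrite (hawkes_intensityE N_poisson mu Phi_meas); congr (_ + _).
rewrite /kappa; case: ifPn => _; last by rewrite integral_measure_zero.
rewrite integral_mrestr//; last 2 first.
- by move=> r; rewrite lee_fin kernel_pos_ge0.
- apply/measurable_EFinP; apply: measurableT_comp (measurable_kernel_pos Phi_meas) _.
  by rewrite /=; apply: measurable_funB.
apply: eq_integral => r /set_mem; rewrite /= in_itv/= => /andP[r0 rv].
by rewrite /f /positive_part_plane (lt_trans r0 rv).
Qed.

End predictable_intensity.

(** * The martingale *)

Section predictable_processes.
Context d (T : measurableType d) (R : realType).
Implicit Type G : R -> set (set T).

(** Fixing the mark at 0 maps the generators of [mpred], cut to nonnegative times, to predictable
    sets. *)
Lemma mpred_predictable G (M : R -> T -> \bar R) : is_filtration G ->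
  measurable_fun setT (fun y : mpred G => M y.2.1 y.1) -> is_predictable G M.
Proof.
move=> [sG _ _] mM B mB.
pose f (z : T * R) : mpred G := (z.1, (z.2, 0)).
pose D : set (T * R) := setT `*` `[0, +oo[.
have GT : G 0 setT by apply/(measurable_sigma_algebraE (sG 0 (lexx 0))); exact: measurableT.
have [p0 pC pU] := @smallest_sigma_algebra _ D
  [set E | (exists2 A, G 0 A & E = A `*` [set 0]) \/
      (exists s t A, [/\ 0 <= s <= t, G s A & E = A `*` `]s, t]])].
have pf (U : set (mpred G)) : measurable U ->
    predictable_sigma_algebra G (D `&` f @^-1` U).
  move: U; apply: smallest_sub.
    split.
    - by rewrite /= preimage_set0 setI0.
    - move=> U /= pU'; rewrite (_ : _ `&` _ = D `\` (D `&` f @^-1` U)); first exact: pC.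
      apply/seteqP; split => z /=; first by move=> [Dz [_ nU]]; split => // -[].
      by move=> [Dz nDU]; split => //; split => // Uz; exact: nDU.
    - by move=> U pU'; rewrite /= preimage_bigcup setI_bigcupr; exact: pU.
  move=> _ [->|[s [t [A [k [J [s0 GA mJ _ ->]]]]]]].
    rewrite [X in predictable_sigma_algebra _ X](_ : _ = setT `*` [set 0]).
      by apply: sub_sigma_algebra; left; exists setT.
    apply/seteqP; split => -[w v]; rewrite /D /= !in_itv/= ?andbT.
      by move=> [[_ v0] [_ [v0' _]]]; split => //; apply/eqP; rewrite eq_le v0'.
    by move=> [_ ->]; rewrite lexx.
  (* The section of a box at mark 0 is empty unless J contains 0. *)
  have [J0|J0] := pselect (J 0); last first.
    rewrite [X in predictable_sigma_algebra _ X](_ : _ = set0)//.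
    by apply/seteqP; split => // -[w v] /= [_ [_ [_]]].
  have [st|ts] := leP s t; last first.
    rewrite [X in predictable_sigma_algebra _ X](_ : _ = set0)//.
    apply/seteqP; split => // -[w v] /= [_ [_ []]]; rewrite in_itv/= => /andP[sv vt].
    by have := lt_le_trans sv vt; rewrite ltNge ltW.
  rewrite [X in predictable_sigma_algebra _ X](_ : _ = A `*` `]s, t]).
    by apply: sub_sigma_algebra; right; exists s, t, A; rewrite s0.
  apply/seteqP; split => -[w v]; rewrite /D /= !in_itv/= ?andbT.
    by move=> [_ [Aw [svt _]]].
  by move=> [Aw /andP[sv vt]]; rewrite sv vt (le_trans s0 (ltW sv)).
have := pf _ (mM measurableT _ mB); rewrite setTI.
congr predictable_sigma_algebra; apply/seteqP; split => -[w v]; rewrite /D /= in_itv/= andbT.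
  by move=> [[_ v0] MB].
by move=> [v0 MB].
Qed.

Lemma predictable_sub G H (M : R -> T -> \bar R) :
  (forall t, 0 <= t -> G t `<=` H t) -> is_predictable G M -> is_predictable H M.
Proof.
move=> GH pM B mB; apply: smallest_sub (pM B mB); first exact: smallest_sigma_algebra.
move=> _ [[A GA ->]|[s [t [A [st GA ->]]]]]; apply: sub_sigma_algebra.
  by left; exists A => //; exact: GH GA.
by right; exists s, t, A; split => //; apply: GH GA; case/andP: st.
Qed.

End predictable_processes.

(** * Compensation and the martingale property *)

Section martingale.
Context d (T : measurableType d) (R : realType) (P : probability T R).
Variable N : T -> {measure set (plane R) -> \bar R}.
Hypothesis N_poisson : is_poisson_random_measure P N.
Variables (mu : R) (Phi : R -> R).
Hypothesis mu_gt0 : 0 < mu.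
Hypothesis Phi_ge0 : forall x, 0 <= x -> 0 <= Phi x.
Hypothesis Phi_meas : measurable_fun (`[0, +oo[%classic : set (measurableTypeR R)) Phi.
Hypothesis ratio_lt1 : (branching_ratio Phi < 1)%E.
Local Open Scope ereal_scope.

Local Notation leb := (@lebesgue_measure R).
Local Notation lambda2 := (leb \x leb).
Local Notation F := (prm_filtration N).
Local Notation total := (hawkes_total N mu Phi).
Local Notation X := (hawkes_X N mu Phi).
Local Notation ell := (hawkes_intensity N mu Phi).
Local Notation M := (hawkes_M N mu Phi).
Local Notation G := (natural_filtration X).

Let FP := prm_filtrationP N_poisson.
Let GP : is_filtration G := natural_filtrationP N_poisson mu Phi_meas.

Lemma hawkes_X_ge0 t w : 0 <= X t w.
Proof. by rewrite (hawkes_X_jump N_poisson mu Phi_meas). Qed.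

Lemma hawkes_X_le s t w : (s <= t)%R -> X s w <= X t w.
Proof.
by move=> st; rewrite !(hawkes_X_jump N_poisson mu Phi_meas); exact: measure_itv_le.
Qed.

Lemma hawkes_intensity_ge0 t w : 0 <= ell t w.
Proof.
rewrite (hawkes_intensityE N_poisson mu Phi_meas); apply: adde_ge0; first by rewrite lee_fin ltW.
case: ifP => // _; apply: integral_ge0 => r _.
by rewrite lee_fin kernel_pos_ge0.
Qed.

Lemma measurable_wrt_prob t (f : T -> \bar R) : (0 <= t)%R ->
  measurable_wrt (F t) f -> measurable_fun setT f.
Proof.
move=> t0 mf _ B mB; rewrite setTI; have [_ Fm _] := FP.
by apply: (Fm _ t0); exact: mf.
Qed.

Lemma measurable_hawkes_X t : (0 <= t)%R -> measurable_fun setT (X t).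
Proof.
by move=> t0; apply: (measurable_wrt_prob t0); exact: (hawkes_X_adapted N_poisson mu Phi_meas).
Qed.

(** Finite means give finiteness almost surely at all integer times at once; monotonicity covers the
    rest. *)
Lemma hawkes_X_finite : {ae P, forall w, forall t, X t w < +oo}.
Proof.
have h n : {ae P, forall w, X n%:R w < +oo}.
  have n0 : (0 <= n%:R :> R)%R by [].
  have iX : P.-integrable setT (X n%:R).
    apply/integrableP; split; first exact: measurable_hawkes_X.
    under eq_integral do rewrite gee0_abs ?hawkes_X_ge0//.
    exact: (mean_hawkes_X N_poisson mu_gt0 Phi_ge0 Phi_meas ratio_lt1).
  have := integrable_ae measurableT iX.
  apply: filterS => w /(_ I); rewrite ge0_fin_numE//.
  exact: hawkes_X_ge0.
have /ae_foralln := h; apply: filterS => w hw t.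
apply: le_lt_trans (hw (Num.truncn t).+1); apply: hawkes_X_le.
by rewrite ltW// truncnS_gt.
Qed.

(** Both sides equal mu plus the integral of phi(v - r) against the jumps in ]0, v[. *)
Lemma intensity_mark w v : (0 < v)%R -> X v w < +oo ->
  ell v w = \int[leb]_(th in `[0%R, +oo[) total (w, (v, th)).
Proof.
move=> v0 Xv; rewrite (hawkes_intensityE N_poisson mu Phi_meas).
rewrite (integral_mark_total N_poisson mu_gt0 Phi_ge0 Phi_meas)//; congr (_ + _).
rewrite ifT; last first.
  apply: le_lt_trans Xv; rewrite (hawkes_X_jump N_poisson mu Phi_meas).
  apply: le_measure; rewrite ?inE// => r /=; rewrite !in_itv/=.
  by move=> /andP[-> /ltW].
rewrite integral_jump_measure//.
- by move=> r /=; rewrite !in_itv/= andbT => /andP[].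
- by move=> r; rewrite kernel_pos_ge0.
- apply: measurableT_comp (measurable_kernel_pos Phi_meas) _.
  by apply: measurable_funB.
Qed.

Let L (s t : R) (w : T) := \int[leb]_(u in `]s, t]) ell u w.

(** Progressive measurability: up to time t, [ell] is jointly measurable for G_t and the Borel
    sets. *)
Let mell (s t : R) (t0 : (0 <= t)%R) (s0 : (0 <= s)%R) :
  exists f : g_sigma_algebraType (G t) * measurableTypeR R -> \bar R,
    [/\ measurable_fun setT f, forall x, 0 <= f x &
     forall w u, (s < u <= t)%R -> ell u w = f (w, u)].
Proof.
pose g (x : g_sigma_algebraType (G t) * measurableTypeR R) : mpred G :=
  (x.1, if (0 < x.2 <= t)%R then (x.2, 0%R) else (0%R, 0%R)).
exists (fun x => ell (g x).2.1 (g x).1); split.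
- apply: (measurableT_comp (f := fun y : mpred G => ell y.2.1 y.1) (g := g)).
    exact: (measurable_intensity N_poisson Phi_ge0 Phi_meas).
  rewrite (_ : g = (fun x : g_sigma_algebraType (G t) * plane R =>
    (x.1, if (0 < x.2.1 <= t)%R then x.2 else (0%R, 0%R)) : mpred G) \o
    (fun x => (x.1, (x.2, 0%R)))); last by apply/funext => -[w u].
  apply: measurableT_comp (measurable_before GP t0) _.
  apply: (measurable_fun_pair measurable_fst).
  exact: (measurable_fun_pair measurable_snd (measurable_cst _)).
- by move=> x; exact: hawkes_intensity_ge0.
- by move=> w u /andP[su ut]; rewrite /g/= (le_lt_trans s0 su) ut.
Qed.

Let L_adapted s t : (0 <= s)%R -> (0 <= t)%R -> measurable_wrt (G t) (L s t).
Proof.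
move=> s0 t0; have [f [mf f0 fE]] := mell t0 s0; have [sG _ _] := GP.
apply/(measurable_wrtP (sG t t0)).
rewrite (_ : L s t = fun w => \int[leb]_(u in `]s, t]) f (w, u)).
  exact: (measurable_integral_param (@lebesgue_sigma_finite R)).
by apply/funext => w; apply: eq_integral => u /set_mem; rewrite /= in_itv/=; exact: fE.
Qed.

Let mellw (s t : R) w : (0 <= s)%R -> (0 <= t)%R ->
  measurable_fun (`]s, t]%classic : set (measurableTypeR R)) (fun u => ell u w).
Proof.
move=> s0 t0; have [f [mf f0 fE]] := mell t0 s0.
apply: (eq_measurable_fun (fun u => f (w, u))).
  by move=> u /set_mem; rewrite /= in_itv/= => /fE ->.
apply: measurable_funTS.
exact: measurableT_comp mf (pair1_measurable (w : g_sigma_algebraType (G t))).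
Qed.

(** Closing the interval at t adds a null set and makes [L] additive over adjacent intervals. *)
Lemma hawkes_ME t w : (0 <= t)%R -> M t w = X t w - L 0 t w.
Proof.
move=> t0; rewrite /hawkes_M /L integral_itv_bndo_bndc//.
apply: measurable_funS (mellw w (lexx 0%R) t0) => //.
by move=> u /=; rewrite !in_itv/= => /andP[-> /ltW].
Qed.

Let L_ge0 s t w : 0 <= L s t w.
Proof. by apply: integral_ge0 => u _; exact: hawkes_intensity_ge0. Qed.

Let L_split s t w : (0 <= s)%R -> (s <= t)%R -> L 0 t w = L 0 s w + L s t w.
Proof.
move=> s0 st; have t0 := le_trans s0 st.
rewrite /L -ge0_integral_setU//.
- congr (integral _ _ _); apply/seteqP; split => u /=; rewrite !in_itv/=.
    by move=> /andP[u0 ut]; have [us|su] := leP u s; [left; rewrite u0|right].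
  by move=> [/andP[-> /le_trans->]//|/andP[su ->]]; rewrite (le_lt_trans s0).
- apply: (measurable_funS _ _ (mellw w (lexx 0%R) t0)) => // u /=; rewrite !in_itv/=.
  by move=> [/andP[-> /le_trans->]//|/andP[su ->]]; rewrite (le_lt_trans s0).
- by move=> u _; exact: hawkes_intensity_ge0.
- apply/disj_setPS => u [] /=; rewrite !in_itv/= => /andP[_ us] /andP[].
  by rewrite ltNge us.
Qed.

Let C (s t : R) (w : T) := \int[lambda2]_(z in strip `]s, t]) total (w, z).

(** The increment of X, defined without a difference so that infinite paths are covered. *)
Let D (s t : R) (w : T) := \int[N w]_(z in strip `]s, t]) total (w, z).

Let mtotal : measurable_fun setT (total : T * plane R -> \bar R).
Proof.
apply: (measurable_mpred_prod N_poisson).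
exact: (measurable_hawkes_total N_poisson mu Phi_meas).
Qed.

Let total0 y : 0 <= total y. Proof. exact: hawkes_total_ge0. Qed.

(** Only almost sure, because [intensity_mark] needs a finite path. *)
Let L_compensator s t : (0 <= s)%R -> {ae P, forall w, L s t w = C s t w}.
Proof.
move=> s0; apply: filterS hawkes_X_finite => w Xoo.
rewrite /C /strip integral_product_setX//; last first.
  exact: measurableT_comp mtotal (pair1_measurable w).
apply: eq_integral => v /set_mem; rewrite /= in_itv/= => /andP[sv _].
by rewrite intensity_mark ?(le_lt_trans s0 sv).
Qed.

Let mL s t : (0 <= s)%R -> (0 <= t)%R -> measurable_fun setT (L s t).
Proof.
move=> s0 t0; apply: (measurable_wrt_prob t0) => B mB.
by apply: (natural_filtration_sub N_poisson Phi_meas); exact: L_adapted.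
Qed.

Let mD s t : measurable_fun setT (D s t).
Proof.
by apply: (measurable_integral_prmT N_poisson) => //; exact: measurable_strip.
Qed.

(** Campbell's formula for g: integrating the mark out of the Lebesgue side leaves the intensity. *)
Let integral_L s t A : (0 <= s)%R -> (s <= t)%R -> F s A ->
  \int[P]_(w in A) L s t w = \int[P]_(w in A) D s t w.
Proof.
move=> s0 st FA; have t0 := le_trans s0 st; have [_ Fm _] := FP.
have mA : measurable A := Fm _ s0 _ FA.
rewrite /D (campbell_between N_poisson s0 st FA)//; last first.
  exact: (measurable_hawkes_total N_poisson mu Phi_meas).
apply: ge0_ae_eq_integral => //.
- by apply: measurable_funTS; exact: mL.
- apply: measurable_funTS.
  apply: (measurable_integral_param (@lambda2_sigma_finite R)) => //.
  exact: measurable_strip.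
- by move=> w _; apply: integral_ge0.
- by apply: filterS (L_compensator t s0) => w h _.
Qed.

Let X_split s t w : (0 <= s)%R -> (s <= t)%R -> X t w = X s w + D s t w.
Proof.
move=> s0 st; rewrite !(hawkes_XE N_poisson mu Phi_meas) /D -ge0_integral_setU//.
- congr (integral _ _ _); apply/seteqP; split => -[u th]; rewrite /strip /= !in_itv/=.
    by move=> [/andP[u0 ut] h]; have [us|su] := leP u s; [left; rewrite u0|right].
  by move=> [[/andP[-> /le_trans->]//]|[/andP[su ->]]]; rewrite (le_lt_trans s0).
- exact: measurable_strip.
- exact: measurable_strip.
- apply: measurable_funTS; exact: measurableT_comp mtotal (pair1_measurable w).
- apply/disj_setPS => -[u th] [[/= + _] [/= + _]]; rewrite !in_itv/= => /andP[_ us] /andP[].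
  by rewrite ltNge us.
Qed.

Let X0 w : X 0 w = 0.
Proof. by rewrite (hawkes_X_jump N_poisson mu Phi_meas) set_itvoc0 measure0. Qed.

Let mean_X t : (0 <= t)%R -> \int[P]_w X t w < +oo.
Proof. exact: (mean_hawkes_X N_poisson mu_gt0 Phi_ge0 Phi_meas ratio_lt1). Qed.

Let integrable_X t : (0 <= t)%R -> P.-integrable setT (X t).
Proof.
move=> t0; apply/integrableP; split; first exact: measurable_hawkes_X.
under eq_integral do rewrite gee0_abs ?hawkes_X_ge0//.
exact: mean_X.
Qed.

Let integrable_L t : (0 <= t)%R -> P.-integrable setT (L 0 t).
Proof.
move=> t0; apply/integrableP; split; first exact: mL.
under eq_integral do rewrite gee0_abs ?L_ge0//.
have [sF _ _] := FP.
rewrite integral_L//.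
  rewrite (_ : D 0 t = X t); first exact: mean_X.
  by apply/funext => w; rewrite (X_split w (lexx 0%R) t0) X0 add0e.
by apply/(measurable_sigma_algebraE (sF 0%R (lexx 0%R))); exact: measurableT.
Qed.

Let M_fun t : (0 <= t)%R -> M t = X t \- L 0 t.
Proof. by move=> t0; apply/funext => w; rewrite hawkes_ME. Qed.

Let integrable_M t : (0 <= t)%R -> P.-integrable setT (M t).
Proof.
by move=> t0; rewrite M_fun//; apply: integrableB => //; [exact: integrable_X|exact: integrable_L].
Qed.

Lemma hawkes_M_adapted t : (0 <= t)%R -> measurable_wrt (G t) (M t).
Proof.
move=> t0; have [sG _ _] := GP.
apply/(measurable_wrtP (sG t t0)); rewrite M_fun//.
apply: emeasurable_funB; apply/(measurable_wrtP (sG t t0)).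
  exact: (natural_adapted N_poisson Phi_meas (lexx t)).
exact: L_adapted.
Qed.

(** From s to t, the integrals of X and of its compensator over A grow by the same number, the
    integral of [D]. It is finite, so it cancels. *)
Lemma hawkes_M_increment s t A : (0 <= s)%R -> (s <= t)%R -> F s A ->
  \int[P]_(w in A) M s w = \int[P]_(w in A) M t w.
Proof.
move=> s0 st FA; have t0 := le_trans s0 st; have [_ Fm _] := FP.
have mA : measurable A := Fm _ s0 _ FA.
have iX r : (0 <= r)%R -> P.-integrable A (X r).
  by move=> /integrable_X; apply: integrableS.
have iL r : (0 <= r)%R -> P.-integrable A (L 0 r).
  by move=> /integrable_L; apply: integrableS.
have XD : \int[P]_(w in A) X t w = \int[P]_(w in A) X s w + \int[P]_(w in A) D s t w.
  rewrite -ge0_integralD//.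
  - by apply: eq_integral => w _; exact: X_split.
  - by move=> w _; exact: hawkes_X_ge0.
  - by apply: measurable_funTS; exact: measurable_hawkes_X.
  - by move=> w _; apply: integral_ge0.
  - by apply: measurable_funTS; exact: mD.
have LD : \int[P]_(w in A) L 0 t w = \int[P]_(w in A) L 0 s w + \int[P]_(w in A) D s t w.
  rewrite -integral_L// -ge0_integralD//.
  - by apply: eq_integral => w _; exact: L_split.
  - by apply: measurable_funTS; exact: mL.
  - by apply: measurable_funTS; exact: mL.
have Dfin : \int[P]_(w in A) D s t w \is a fin_num.
  have := integrable_fin_num mA (iX t t0); rewrite XD.
  by rewrite fin_numD => /andP[].
have ME r : (0 <= r)%R ->
    \int[P]_(w in A) M r w = \int[P]_(w in A) X r w - \int[P]_(w in A) L 0 r w.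
  by move=> r0; rewrite M_fun// (integralB mA (iX r r0) (iL r r0)).
rewrite (ME s s0) (ME t t0) XD LD.
have [x xE] : exists x, \int[P]_(w in A) X s w = x%:E.
  by exists (fine (\int[P]_(w in A) X s w)); rewrite fineK//; exact: integrable_fin_num (iX s s0).
have [y yE] : exists y, \int[P]_(w in A) L 0 s w = y%:E.
  by exists (fine (\int[P]_(w in A) L 0 s w)); rewrite fineK//; exact: integrable_fin_num (iL s s0).
rewrite xE yE -(fineK Dfin) -(EFinD x) -(EFinD y) -!EFinB; congr EFin; ring.
Qed.

(** M is adapted to the smaller filtration G and its increments are centred on events of the larger
    F, so any filtration in between will do. *)
Lemma hawkes_M_martingale (H : R -> set (set T)) : is_filtration H ->
  (forall t, (0 <= t)%R -> G t `<=` H t) -> (forall t, (0 <= t)%R -> H t `<=` F t) ->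
  is_martingale P H M.
Proof.
move=> fH GH HF.
have aM t : (0 <= t)%R -> measurable_wrt (H t) (M t).
  by move=> t0 B mB; apply: GH => //; exact: hawkes_M_adapted.
split; [exact: fH|exact: aM|exact: integrable_M|move=> s t s0 st; split].
- exact: aM.
- exact: integrable_M.
- by move=> A HA; apply: hawkes_M_increment => //; exact: HF.
Qed.

End martingale.

Theorem theorem5p2 (R : realType) (d : measure_display) (T : measurableType d)
    (P : probability T R)
    (N : T -> {measure set (plane R) -> \bar R})
    (mu : R) (Phi : R -> R)
    (N_poisson : is_poisson_random_measure P N)
    (mu_gt0 : 0 < mu)
    (Phi_ge0 : forall x, 0 <= x -> 0 <= Phi x)
    (Phi_L1 : (@lebesgue_measure R).-integrable `[0, +oo[ (EFin \o Phi))
    (Phi_lt1 : (\int[lebesgue_measure]_(x in `[0%R, +oo[) `|Phi x|%:E < 1)%E) :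
  let X := hawkes_X N mu Phi in
  let ell := hawkes_intensity N mu Phi in
  let M := hawkes_M N mu Phi in
  [/\ {ae P, forall w,
        [/\ forall t, 0 <= t -> exists k : nat, X t w = k%:R%:E,
            forall s t, 0 <= s -> s <= t -> (X s w <= X t w)%E &
            piecewise_constant (fun t => X t w)]},
      is_predictable (prm_filtration N) ell,
      is_martingale P (prm_filtration N) M &
      is_martingale P (natural_filtration X) M].
Proof.
move=> X ell M.
have Phi_meas : measurable_fun (`[0, +oo[%classic : set (measurableTypeR R)) Phi.
  by apply/measurable_EFinP; exact: measurable_int Phi_L1.
have ratio_lt1 : (branching_ratio Phi < 1)%E.
  rewrite (_ : branching_ratio Phi = (\int[lebesgue_measure]_(x in `[0%R, +oo[) `|Phi x|%:E)%E)//.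
  rewrite [RHS]integral_mkcond; apply: eq_integral => x _.
  rewrite /kernel_pos !patchE; case: ifPn => // /set_mem; rewrite /= in_itv/= andbT => x0.
  by rewrite ger0_norm ?Phi_ge0.
have GP := natural_filtrationP N_poisson mu Phi_meas.
have FP := prm_filtrationP N_poisson.
have GF t : natural_filtration X t `<=` prm_filtration N t.
  exact: (natural_filtration_sub N_poisson Phi_meas).
have XE t w := hawkes_X_jump N_poisson mu Phi_meas w t.
split.
- have := hawkes_X_finite N_poisson mu_gt0 Phi_ge0 Phi_meas ratio_lt1.
  apply: filterS => w Xoo; split => [t t0|s t s0 st|].
  + have := Xoo t; rewrite /X XE.
    by case: (enat_jump_measure N_poisson mu Phi_meas w (measurable_itv `]0, t])) => [->|].
  + exact: (hawkes_X_le N_poisson).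
  + rewrite (_ : (fun t => X t w) = fun t => jump_measure N_poisson mu Phi_meas w `]0, t]%classic).
      apply: distribution_piecewise_constant; first exact: enat_jump_measure.
      by move=> t; rewrite -XE.
    by apply/funext => t; exact: XE.
(* Predictability is established for the filtration of X and passes to the larger one of N. *)
- apply: (predictable_sub (G := natural_filtration X)) => //.
  apply: mpred_predictable => //.
  exact: (measurable_intensity N_poisson Phi_ge0 Phi_meas).
- by apply: (hawkes_M_martingale N_poisson mu_gt0 Phi_ge0 Phi_meas ratio_lt1) => // t _.
- by apply: (hawkes_M_martingale N_poisson mu_gt0 Phi_ge0 Phi_meas ratio_lt1) => // t _.
Qed.
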